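(* Let $\Gamma$ be a group of finite type, let $A$ be a finite abelian group, let $(\mathrm P,\mu)$ be a measured $\Gamma$-Boolean algebra and let $\mathcal P$ be a family of measured $\Gamma$-Boolean algebras. If $$|||\theta^{\mathrm P}_*(\alpha)|||_\mu<\inf\{|||\theta^{\mathrm Q}_*(\alpha)|||_\nu \mid (\mathrm Q,\nu)\in\mathcal P\}$$ for some $i\ge 0$ and some $\alpha\in\mathrm H^i(\Gamma,A)$, then $(\mathrm P,\mu)$ is not weakly contained in the family $\mathcal P$.
   Context: **Measured Boolean algebras.** A measured Boolean algebra $(\mathrm P,\mu)$ is a Boolean algebra with a map $\mu\colon\mathrm P\to[0,1]$ with $\mu(X\cup Y)+\mu(X\cap Y)=\mu(X)+\mu(Y)$, $\mu(0)=0$, $\mu(1)=1$; put $d(X,Y)=\mu(X\cup Y)-\mu(X\cap Y)$. A measured $\Gamma$-Boolean algebra carries in addition a measure-preserving $\Gamma$-action by Boolean automorphisms. For a finite abelian group $A$, $\mathrm P(A)$ is the abelian group generated by symbols $X\otimes a$ ($X\in\mathrm P$, $a\in A$) subject to $X\otimes a+Y\otimes b=(X\setminus Y)\otimes a+(Y\setminus X)\otimes b+(X\cap Y)\otimes(a+b)$. Every $x\in\mathrm P(A)$ is uniquely $\sum_{a\ne0}X_a\otimes a$ with pairwise disjoint $X_a$; put $\mu(x)=\sum_{a\ne0}\mu(X_a)$. $\mathrm P(A)$ is a $\mathbb Z[\Gamma]$-module. The map $\theta^{\mathrm P}\colon A\to\mathrm P(A)$, $a\mapsto1\otimes a$, induces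 $\theta^{\mathrm P}_*\colon\mathrm H^i(\Gamma,A)\to\mathrm H^i(\Gamma,\mathrm P(A))$. **Norms.** $\Gamma$ is of finite type if it has a finite classifying space $B\Gamma=E\Gamma/\Gamma$ with $E\Gamma$ a contractible simplicial complex with free simplicial $\Gamma$-action; fix such a model and faithful probability measures $\nu_i$ on the sets $B\Gamma(i)$ of $i$-simplices. $\mathrm H^i(\Gamma,M)=\mathrm H^i(B\Gamma,M)$ is computed from $\mathrm C^i(B\Gamma,M)=\hom_{\mathbb Z\Gamma}(\mathrm C_i(E\Gamma),M)$. For $c\in\mathrm C^i(B\Gamma,\mathrm P(A))$ put $\|c\|=\sum_{x\in B\Gamma(i)}\mu(c(\tilde x))\nu_i(x)$ ($\tilde x\in E\Gamma(i)$ any lift of $x$), and for $\beta\in\mathrm H^i(\Gamma,\mathrm P(A))$ let $|||\beta|||_\mu$ be the infimum of $\|c\|$ over cocycles $c$ representing $\beta$. **Weak containment.** For measured $\Gamma$-Boolean algebras $(\mathrm P_j,\mu_j)_{j\in I}$ and a non-principal ultrafilter $\mathcal U$ on $I$, the metric ultraproduct is $\mathrm P_{\mathcal U}=\prod_j\mathrm P_j/\sim$ with $(X_j)\sim(Y_j)$ iff $\lim_{j\to\mathcal U}d_j(X_j,Y_j)=0$, measure $\mu_{\mathcal U}([X_j]_j)=\lim_{j\to\mathcal U}\mu_j(X_j)$ and the induced $\Gamma$-action. $(\mathrm P,\mu)$ is contained in $(\mathrm Q,\nu)$ if there is a measure-preserving $\Gamma$-equivariant homomorphism of Boolean algebras $\mathrm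 P\to\mathrm Q$; it is weakly contained in a family if it is contained in a metric ultraproduct of members of that family. *)

(* Defs.v *)
From HB Require Import structures.
From mathcomp Require Import all_boot all_order all_algebra perm finmap.
From mathcomp Require Import all_classical all_reals all_analysis.
From mathcomp.multinomials Require Import freeg.
From mathcomp Require Import fintype zify lra.

Set Implicit Arguments.
Unset Strict Implicit.
Unset Printing Implicit Defensive.

Import Order.Theory GRing.Theory Num.Theory.
Import numFieldNormedType.Exports.

Local Open Scope classical_set_scope.
Local Open Scope ring_scope.
Local Open Scope quotient_scope.

(* The abelian group presented by generators G and relations r = 0 for r in rel:
   free abelian group modulo the smallest subgroup containing rel. *)
Section Presentation.
Variables (G : choiceType) (rel : set {freeg G / int}).

Definition rel_span : {pred {freeg G / int}} :=
  fun x => `[< forall H : zmodClosed {freeg G / int},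
                  (forall r, rel r -> r \in H) -> x \in H >].

Lemma rel_span_zmod_closed : zmod_closed rel_span.
Proof.
split=> [|x y]; first by apply/asboolP => H _; exact: rpred0.
move=> /asboolP Hx /asboolP Hy; apply/asboolP => H relH.
by apply: rpredB; [exact: Hx|exact: Hy].
Qed.
HB.instance Definition _ :=
  GRing.isZmodClosed.Build {freeg G / int} rel_span rel_span_zmod_closed.

Definition presented : zmodType := {ideal_quot rel_span}.

Definition pgen (g : G) : presented :=
  \pi_{ideal_quot rel_span} (<< 1 *g g >> : {freeg G / int}).

(* Universal property: f extends to the presented group as soon as it kills the
   relations (plift_additive, plift_pgen). *)
Definition plift (M : zmodType) (f : G -> M) (x : presented) : M :=
  fglift (f : G -> zmodule M) (repr (x : {ideal_quot rel_span})).

Section Lift.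
Variables (M : zmodType) (f : G -> M).
Hypothesis f_rel : forall r, rel r -> fglift (f : G -> zmodule M) r = 0.

Let ker : {pred {freeg G / int}} := fun x => fglift (f : G -> zmodule M) x == 0.

Let fgliftB x y :
  fglift (f : G -> zmodule M) (x - y) = fglift (f : G -> zmodule M) x - fglift (f : G -> zmodule M) y.
Proof. exact: lift_is_additive. Qed.

Let ker_closed : zmod_closed ker.
Proof.
split=> [|x y]; first by rewrite unfold_in -(subrr 0) fgliftB subrr.
by rewrite !unfold_in fgliftB => /eqP-> /eqP->; rewrite subrr.
Qed.

Lemma plift_pi (x : {freeg G / int}) :
  plift f (\pi_{ideal_quot rel_span} x) = fglift (f : G -> zmodule M) x.
Proof.
apply/eqP; rewrite -subr_eq0 -fgliftB.
have /eqP : \pi_{ideal_quot rel_span} (repr (\pi_{ideal_quot rel_span} x)) = \pi_{ideal_quot rel_span} x.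
  by rewrite reprK.
rewrite -Quotient.idealrBE => /asboolP.
pose kerZ := GRing.isZmodClosed.Build _ ker ker_closed.
pose kerC : zmodClosed _ := HB.pack ker kerZ.
by move=> /(_ kerC)/=; apply => r /f_rel/eqP.
Qed.

Lemma plift_additive : zmod_morphism (plift f).
Proof.
move=> x y; rewrite -[x](@reprK _ {ideal_quot rel_span}) -[y](@reprK _ {ideal_quot rel_span}).
by rewrite -raddfB !plift_pi fgliftB.
Qed.

Lemma plift_pgen g : plift f (pgen g) = f g.
Proof. by rewrite plift_pi liftU scale1r. Qed.

End Lift.

Lemma presented_ind (Q : presented -> Prop) :
    Q 0 -> (forall x y, Q x -> Q y -> Q (x - y)) -> (forall g, Q (pgen g)) ->
  forall x, Q x.
Proof.
move=> Q0 QB Qg x; rewrite -[x](@reprK _ {ideal_quot rel_span}).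
have QN y : Q y -> Q (- y) by rewrite -sub0r; exact: QB.
have QD y z : Q y -> Q z -> Q (y + z).
  by move=> Qy /QN; rewrite -{2}[z]opprK; exact: QB.
have Qn y n : Q y -> Q (y *+ n).
  by move=> Qy; elim: n => [|n ih]; rewrite ?mulr0n// mulrS; exact: QD.
rewrite -[repr _]freeg_sumE raddf_sum.
elim/big_ind: _ => // g _; set k := coeff _ _.
have -> : << k *g g >> = << 1 *g g >> *~ k :> {freeg G / int}.
  by rewrite freeg_mulz intz.
rewrite raddfMz; case: k => n; first exact/Qn/Qg.
exact/QN/Qn/Qg.
Qed.

Lemma presented_eq (M : zmodType) (u v : presented -> M) :
    zmod_morphism u -> zmod_morphism v ->
  (forall g, u (pgen g) = v (pgen g)) -> u =1 v.
Proof.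
move=> uB vB uv; apply: presented_ind => // [|x y ux uy].
  by rewrite -(subrr 0) uB vB !subrr.
by rewrite uB vB ux uy.
Qed.

Lemma pi_rel r : rel r -> \pi_{ideal_quot rel_span} r = 0 :> presented.
Proof.
move=> relr; have : r - 0 \in rel_span by rewrite subr0; apply/asboolP => H; exact.
by rewrite Quotient.idealrBE => /eqP ->; rewrite raddf0.
Qed.

End Presentation.

(* A Z[Gam]-module, given as an abelian group with an additive left Gam-action;
   ghom M N is hom_{Z Gam}(M, N). *)
Record gmodule (Gam : groupType) := GModule {
  gmod_sort :> zmodType;
  gact : Gam -> gmod_sort -> gmod_sort;
  gactB : forall g, zmod_morphism (gact g);
  gact1 : forall x, gact 1%g x = x;
  gactM : forall g h x, gact (g * h)%g x = gact g (gact h x) }.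

Section Ghom.
Variable Gam : groupType.

Definition is_ghom (M N : gmodule Gam) (f : M -> N) : Prop :=
  zmod_morphism f /\ (forall g x, f (gact g x) = gact g (f x)).

Definition is_ghomb (M N : gmodule Gam) : {pred M -> N} :=
  fun f => `[< is_ghom f >].

Record ghom (M N : gmodule Gam) := Ghom {
  ghom_fun :> M -> N;
  ghom_subproof : is_ghomb ghom_fun }.

HB.instance Definition _ M N := [isSub for @ghom_fun M N].
HB.instance Definition _ M N := [Choice of ghom M N by <:].

Lemma is_ghomb_closed M N : zmod_closed (@is_ghomb M N).
Proof.
have act0 g : gact g 0 = 0 :> N by rewrite -(subrr 0) gactB !subrr.
split=> [|f1 f2 /asboolP[f1B f1J] /asboolP[f2B f2J]]; apply/asboolP; split.
- by move=> x y; rewrite /= subrr.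
- by move=> g x; rewrite /= act0.
- by move=> x y; rewrite !fctE /= f1B f2B !opprD addrACA.
- by move=> g x; rewrite !fctE /= gactB f1J f2J.
Qed.
HB.instance Definition _ M N :=
  GRing.isZmodClosed.Build _ (@is_ghomb M N) (@is_ghomb_closed M N).
HB.instance Definition _ M N := [SubChoice_isSubZmodule of ghom M N by <:].

Lemma ghomP M N (f : ghom M N) : is_ghom f.
Proof. by have /asboolP := ghom_subproof f. Qed.

Lemma is_ghom_comp (L M N : gmodule Gam) (f : ghom M N) (h : ghom L M) :
  is_ghomb (f \o h).
Proof.
have [fB fJ] := ghomP f; have [hB hJ] := ghomP h.
by apply/asboolP; split=> [x y|g x] /=; rewrite (hB, hJ) (fB, fJ).
Qed.

Definition gcomp (L M N : gmodule Gam) (f : ghom M N) (h : ghom L M) : ghom L N :=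
  Ghom (is_ghom_comp f h).

End Ghom.

(* Abstract simplicial complexes; simplices are nonempty. *)
Record simplicial_complex := SimplicialComplex {
  vertex : choiceType;
  simplices : {pred {fset vertex}};
  simplex_neq0 : fset0 \notin simplices;
  simplexS : forall s t : {fset vertex},
    s \in simplices -> (t `<=` s)%fset -> t != fset0 -> t \in simplices;
  simplex1 : forall v, [fset v]%fset \in simplices }.

Arguments simplices : clear implicits.

(* A simplicial action is free on the geometric realization iff no simplex is
   stabilized setwise by g != 1 (otherwise its barycentre would be fixed), which
   is what vact_free says. *)
Record gcomplex (Gam : groupType) := GComplex {
  cplx :> simplicial_complex;
  vact : Gam -> vertex cplx -> vertex cplx;
  vact1 : forall v, vact 1%g v = v;
  vactM : forall g h v, vact (g * h)%g v = vact g (vact h v);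
  vact_simplex : forall g s,
    s \in simplices cplx -> [fset vact g v | v in s]%fset \in simplices cplx;
  vact_free : forall g s,
    s \in simplices cplx -> [fset vact g v | v in s]%fset = s -> g = 1%g }.

Section Chains.
Variables (Gam : groupType) (E : gcomplex Gam).

(* An n-simplex together with an ordering of its n+1 vertices. *)
Definition is_osimplex n (x : {ffun 'I_n.+1 -> vertex E}) : bool :=
  injectiveb x && ([fset x i | i in 'I_n.+1]%fset \in simplices E).

Record osimplex n := OSimplex {
  overt :> {ffun 'I_n.+1 -> vertex E};
  osimplexP : is_osimplex overt }.

HB.instance Definition _ n := [isSub for @overt n].
HB.instance Definition _ n := [Choice of osimplex n by <:].

Definition osupport n (x : osimplex n) : {fset vertex E} :=
  [fset x i | i in 'I_n.+1]%fset.

Fact operm_subproof n (s : 'S_n.+1) (x : osimplex n) :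
  is_osimplex [ffun i => x (s i)].
Proof.
have /andP[/injectiveP x_inj xE] := osimplexP x; apply/andP; split.
  by apply/injectiveP => i j; rewrite !ffunE => /x_inj/perm_inj.
suff -> : [fset [ffun i => x (s i)] i | i in 'I_n.+1]%fset = osupport x by [].
apply/fsetP => v; apply/imfsetP/imfsetP => -[i _ ->].
  by exists (s i); rewrite ?ffunE.
by exists (s^-1%g i); rewrite ?ffunE ?permKV.
Qed.
Definition operm n (s : 'S_n.+1) (x : osimplex n) := OSimplex (operm_subproof s x).

Fact oface_subproof n (i : 'I_n.+2) (x : osimplex n.+1) :
  is_osimplex [ffun j => x (lift i j)].
Proof.
have /andP[/injectiveP x_inj xE] := osimplexP x; apply/andP; split.
  by apply/injectiveP => j k; rewrite !ffunE => /x_inj/lift_inj.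
apply: simplexS xE _ _.
  apply/fsubsetP => v /imfsetP[j _ ->]; rewrite ffunE.
  by apply/imfsetP; exists (lift i j).
apply/fset0Pn; exists (x (lift i ord0)); apply/imfsetP.
by exists ord0; rewrite ?ffunE.
Qed.
Definition oface n (i : 'I_n.+2) (x : osimplex n.+1) := OSimplex (oface_subproof i x).

Lemma vact_inj g : injective (@vact _ E g).
Proof.
move=> v w /(congr1 (@vact _ E g^-1%g)).
by rewrite -!vactM mulVg !vact1.
Qed.

Fact oact_subproof n (g : Gam) (x : osimplex n) : is_osimplex [ffun i => vact g (x i)].
Proof.
have /andP[/injectiveP x_inj xE] := osimplexP x; apply/andP; split.
  by apply/injectiveP => j k; rewrite !ffunE => /vact_inj/x_inj.
suff -> : [fset [ffun i => vact g (x i)] i | i in 'I_n.+1]%fset =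
    [fset vact g v | v in osupport x]%fset by exact: vact_simplex.
apply/fsetP => v; apply/imfsetP/imfsetP => [[i _ ->]|[_ /imfsetP[i _ ->] ->]].
  by exists (x i); rewrite ?ffunE//; apply/imfsetP; exists i.
by exists i; rewrite ?ffunE.
Qed.
Definition oact n (g : Gam) (x : osimplex n) := OSimplex (oact_subproof g x).

(* C_n(E) is the group of oriented chains: reordering the vertices of a simplex
   by s multiplies the generator by the sign of s. *)
Definition orient_rel n : set {freeg (osimplex n) / int} :=
  [set r | exists x (s : 'S_n.+1), r = << 1 *g operm s x >> - << (-1) ^+ s *g x >>].

Definition chain_zmod n : zmodType := presented (@orient_rel n).
Definition chain_gen n (x : osimplex n) : chain_zmod n := pgen (@orient_rel n) x.

Lemma chain_gen_perm n (s : 'S_n.+1) (x : osimplex n) :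
  chain_gen (operm s x) = chain_gen x *~ ((-1) ^+ s).
Proof.
have /pi_rel : @orient_rel n (<< 1 *g operm s x >> - << (-1) ^+ s *g x >>).
  by exists x, s.
rewrite raddfB => /eqP; rewrite subr_eq0 => /eqP.
rewrite /chain_gen /pgen => ->.
by rewrite -raddfMz freeg_mulz intz.
Qed.

Lemma orient_rel_lift n (M : zmodType) (f : osimplex n -> M) :
    (forall x (s : 'S_n.+1), f (operm s x) = f x *~ ((-1) ^+ s)) ->
  forall r, orient_rel r -> fglift (f : osimplex n -> zmodule M) r = 0.
Proof.
move=> fs _ [x [s ->]].
rewrite (lift_is_additive (M := zmodule M)) !liftU scale1r fs.
exact: subrr.
Qed.

Definition chain_act n (g : Gam) : chain_zmod n -> chain_zmod n :=
  plift (fun x => chain_gen (oact g x)).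

Fact chain_act_rel n g r : @orient_rel n r ->
  fglift ((fun x => chain_gen (oact g x)) : osimplex n -> zmodule (chain_zmod n)) r = 0.
Proof.
apply: orient_rel_lift => x s; rewrite -chain_gen_perm; congr chain_gen.
by apply/val_inj/ffunP => i; rewrite !ffunE.
Qed.

Lemma chain_actB n g : zmod_morphism (@chain_act n g).
Proof. exact/plift_additive/chain_act_rel. Qed.

Lemma chain_act_gen n g (x : osimplex n) :
  chain_act g (chain_gen x) = chain_gen (oact g x).
Proof. exact/plift_pgen/chain_act_rel. Qed.

Lemma chain_act1 n (c : chain_zmod n) : chain_act 1%g c = c.
Proof.
move: c; apply: presented_eq => //; first exact: chain_actB.
move=> x; rewrite -[pgen _ _]/(chain_gen x) chain_act_gen; congr chain_gen.
by apply/val_inj/ffunP => i; rewrite !ffunE vact1.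
Qed.

Lemma chain_actM n g h (c : chain_zmod n) :
  chain_act (g * h)%g c = chain_act g (chain_act h c).
Proof.
move: c; apply: presented_eq => //; first exact: chain_actB.
  by move=> x y; rewrite !chain_actB.
move=> x; rewrite -[pgen _ _]/(chain_gen x) !chain_act_gen; congr chain_gen.
by apply/val_inj/ffunP => i; rewrite !ffunE vactM.
Qed.

Definition chain n : gmodule Gam :=
  GModule (@chain_actB n) (@chain_act1 n) (@chain_actM n).

Definition boundary_gen n (x : osimplex n.+1) : chain n :=
  \sum_(i < n.+2) chain_gen (oface i x) *~ ((-1) ^+ i).

Definition boundary_fun n : chain n.+1 -> chain n := plift (@boundary_gen n).

Lemma perm_lift_perm n (s : 'S_n.+1) (i : 'I_n.+1) :
  {t : 'S_n | s = lift_perm i (s i) t}.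
Proof.
have neq j : s i != s (lift i j) by rewrite (inj_eq perm_inj) neq_lift.
pose tf j := odflt j (unlift (s i) (s (lift i j))).
have tfE j : lift (s i) (tf j) = s (lift i j).
  by rewrite /tf; have [k -> ->] := unlift_some (neq j).
have tf_inj : injective tf.
  by move=> j k /(congr1 (lift (s i))); rewrite !tfE => /perm_inj/lift_inj.
exists (perm tf_inj); apply/permP => k.
have [j|] := unliftP i k; last by move=> ->; rewrite lift_perm_id.
by move=> ->; rewrite lift_perm_lift permE tfE.
Qed.

Fact boundary_rel n r : @orient_rel n.+1 r ->
  fglift ((@boundary_gen n) : osimplex n.+1 -> zmodule (chain n)) r = 0.
Proof.
apply: orient_rel_lift => x s; rewrite /boundary_gen mulrz_suml.
rewrite [RHS](reindex_inj (@perm_inj _ s)) /=; apply: eq_bigr => i _.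
have [t st] := perm_lift_perm s i.
have -> : oface i (operm s x) = operm t (oface (s i) x).
  by apply/val_inj/ffunP => j; rewrite !ffunE {1}st lift_perm_lift.
rewrite chain_gen_perm -!mulrzA; congr (_ *~ _).
have -> : odd_perm s = odd i (+) odd (s i) (+) t by rewrite {1}st odd_lift_perm.
by rewrite 2!signr_addb !signr_odd -mulrA mulrCA [(-1) ^+ s i * (_ * _)]mulrA -expr2 sqrr_sign mul1r mulrC.
Qed.

Lemma boundaryB n : zmod_morphism (@boundary_fun n).
Proof. exact/plift_additive/boundary_rel. Qed.

Lemma boundary_chain_gen n (x : osimplex n.+1) :
  boundary_fun (chain_gen x) = \sum_(i < n.+2) chain_gen (oface i x) *~ ((-1) ^+ i).
Proof. exact/plift_pgen/boundary_rel. Qed.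

Fact boundary_subproof n : is_ghomb (@boundary_fun n : chain n.+1 -> chain n).
Proof.
apply/asboolP; split=> [|g]; first exact: boundaryB.
apply: presented_eq => [x y|x y|x].
- by rewrite /= chain_actB boundaryB.
- by rewrite /= boundaryB chain_actB.
rewrite -[pgen _ _]/(chain_gen x) /= chain_act_gen !boundary_chain_gen.
pose act_add := GRing.isZmodMorphism.Build _ _ _ (@chain_actB n g).
pose act : {additive chain n -> chain n} := HB.pack (@chain_act n g) act_add.
rewrite -[chain_act g]/(act : _ -> _) raddf_sum; apply: eq_bigr => i _.
rewrite raddfMz /= chain_act_gen; congr (chain_gen _ *~ _).
by apply/val_inj/ffunP => j; rewrite !ffunE.
Qed.
Definition chain_boundary n : ghom (chain n.+1) (chain n) := Ghom (@boundary_subproof n).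

Lemma alternating_sum0 (M : zmodType) m (F : nat -> nat -> M) :
    (forall i j, (i <= j)%N -> (j < m)%N -> F j.+1 i = - F i j) ->
  \sum_(i < m.+1) \sum_(j < m) F i j = 0.
Proof.
elim: m => [|m ih] Fm; first by rewrite big1// => i _; rewrite big_ord0.
rewrite big_ord_recr /=; under eq_bigr do rewrite big_ord_recr /=.
rewrite big_split /= ih ?add0r => [|i j ij jm]; last by rewrite Fm// ltnW.
rewrite -big_split big1//= => i _.
by rewrite [F m.+1 i]Fm ?subrr// -ltnS.
Qed.

Lemma boundaryK n (c : chain n.+2) : chain_boundary n (chain_boundary n.+1 c) = 0.
Proof.
have bB k := (ghomP (chain_boundary k)).1.
move: c; apply: presented_eq => [x y|x y|x]; rewrite ?bB ?subrr//.
rewrite -[pgen _ _]/(chain_gen x) /= boundary_chain_gen.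
pose bd_add := GRing.isZmodMorphism.Build _ _ _ (@boundaryB n).
pose bd : {additive chain n.+1 -> chain n} := HB.pack (@boundary_fun n) bd_add.
rewrite -[@boundary_fun n]/(bd : _ -> _) raddf_sum.
under eq_bigr do rewrite raddfMz /= boundary_chain_gen mulrz_suml.
pose F (i : 'I_n.+3) (j : 'I_n.+2) : chain n :=
  chain_gen (oface j (oface i x)) *~ ((-1) ^+ j) *~ ((-1) ^+ i).
pose G i j := F (inord i) (inord j).
transitivity (\sum_(i < n.+3) \sum_(j < n.+2) G i j).
  by apply: eq_bigr => i _; apply: eq_bigr => j _; rewrite /G !inord_val.
apply: alternating_sum0 => i j ij jn; rewrite /G /F !inordK; [|lia..].
rewrite -!mulrzA -mulrNz; congr (_ *~ _); last first.
  by rewrite exprS mulN1r mulrN mulrC.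
congr chain_gen; apply/val_inj/ffunP => k; rewrite !ffunE; congr (overt x _).
by apply/val_inj => /=; rewrite !inordK /bump; lia.
Qed.

End Chains.

Section Cohomology.
Variables (Gam : groupType) (E : gcomplex Gam).

Definition cochain n (M : gmodule Gam) := ghom (chain E n) M.

Definition coboundary n M (c : cochain n M) : cochain n.+1 M :=
  gcomp c (chain_boundary E n).

Section Coefficients.
Variables (n : nat) (M : gmodule Gam).

Definition is_cocycle : {pred cochain n M} := fun c => coboundary c == 0.

Lemma is_cocycle_closed : zmod_closed is_cocycle.
Proof.
split=> [|c d]; rewrite !unfold_in; first by apply/eqP/val_inj.
move=> /eqP c0 /eqP d0; apply/eqP/val_inj/funext => x.
have cx : coboundary c x = 0 by rewrite c0.
have dx : coboundary d x = 0 by rewrite d0.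
change (coboundary c x - coboundary d x = 0).
by rewrite cx dx subrr.
Qed.
HB.instance Definition _ :=
  GRing.isZmodClosed.Build _ is_cocycle is_cocycle_closed.

Record cocycle := Cocycle {
  cocycle_cochain :> cochain n M;
  cocycleP : is_cocycle cocycle_cochain }.
HB.instance Definition _ := [isSub for cocycle_cochain].
HB.instance Definition _ := [Choice of cocycle by <:].
HB.instance Definition _ := [SubChoice_isSubZmodule of cocycle by <:].

End Coefficients.

(* In degree 0 there are no nonzero coboundaries (C^{-1} = 0). *)
Definition is_coboundary n M : {pred cocycle n M} :=
  match n with
  | 0 => fun c => c == 0
  | m.+1 => fun c => `[< exists b : cochain m M, coboundary b = c :> cochain m.+1 M >]
  end.

Lemma is_coboundary_closed n M : zmod_closed (@is_coboundary n M).
Proof.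
case: n => [|n]; split=> [|c d]; rewrite ?unfold_in /=.
- by [].
- by move=> /eqP -> /eqP ->; rewrite subrr.
- by apply/asboolP; exists 0; apply/val_inj.
move=> /asboolP[b bc] /asboolP[b' bd]; apply/asboolP; exists (b - b').
by rewrite /= -bc -bd; exact/val_inj.
Qed.
HB.instance Definition _ n M :=
  GRing.isZmodClosed.Build _ (@is_coboundary n M) (@is_coboundary_closed n M).

(* H^n(Gam, M), computed as H^n(E/Gam, M) from hom_{Z Gam}(C_n(E), M). *)
Definition cohomology n M : zmodType := {ideal_quot @is_coboundary n M}.

Definition coclass n M (c : cocycle n M) : cohomology n M :=
  \pi_{ideal_quot @is_coboundary n M} c.

Section Functoriality.
Variables (n : nat) (M N : gmodule Gam) (f : ghom M N).

Fact cocycle_map_subproof (c : cocycle n M) : is_cocycle (gcomp f (c : cochain n M)).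
Proof.
have [fB _] := ghomP f; apply/eqP/val_inj/funext => x /=.
have /eqP/(congr1 (fun f : ghom _ _ => f x))/= -> := cocycleP c.
by rewrite -(subrr 0) fB !subrr.
Qed.
Definition cocycle_map (c : cocycle n M) : cocycle n N :=
  Cocycle (cocycle_map_subproof c).

End Functoriality.

Definition cohomology_map n (M N : gmodule Gam) (f : ghom M N)
    (x : cohomology n M) : cohomology n N :=
  coclass (cocycle_map f (repr (x : {ideal_quot @is_coboundary n M}))).

Lemma cocycle_map_coboundary n (M N : gmodule Gam) (f : ghom M N) (c : cocycle n M) :
  c \in @is_coboundary n M -> cocycle_map f c \in @is_coboundary n N.
Proof.
rewrite !unfold_in; have [fB _] := ghomP f; case: n c => [|n] c /=.
  move=> /eqP ->; apply/eqP/val_inj/val_inj/funext => x /=.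
  by rewrite -(subrr 0) fB !subrr.
move=> /asboolP[b bc]; apply/asboolP; exists (gcomp f b).
by rewrite -bc; exact/val_inj.
Qed.

Lemma cohomology_map_coclass n (M N : gmodule Gam) (f : ghom M N) (c : cocycle n M) :
  cohomology_map f (coclass c) = coclass (cocycle_map f c).
Proof.
have [fB _] := ghomP f.
apply/eqP; rewrite -Quotient.idealrBE.
set r := repr _.
have : r - c \in @is_coboundary n M by rewrite Quotient.idealrBE reprK.
have -> : cocycle_map f r - cocycle_map f c = cocycle_map f (r - c).
  by apply/val_inj/val_inj/funext => x /=; rewrite fB.
exact: cocycle_map_coboundary.
Qed.

End Cohomology.

(* The library's {tblmorphism P -> Q} only records preservation of bottom and top.
   Preservation of bottom, top and difference follows from the clauses below. *)
Definition boolean_hom d d' (P : ctbDistrLatticeType d) (Q : ctbDistrLatticeType d')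
    (f : P -> Q) : Prop :=
  [/\ {morph f : X Y / (X `|` Y)%O}, {morph f : X Y / (X `&` Y)%O}
    & {morph f : X / (~` X)%O}].

Section BooleanHom.
Variables (d d' : Order.disp_t) (P : ctbDistrLatticeType d) (Q : ctbDistrLatticeType d').
Variables (f : P -> Q) (fP : boolean_hom f).

Lemma boolean_hom0 : f \bot%O = \bot%O.
Proof. by have [_ fI fC] := fP; rewrite -(meetxC \bot%O) fI fC meetxC. Qed.

Lemma boolean_hom1 : f \top%O = \top%O.
Proof. by have [fU _ fC] := fP; rewrite -(joinxC \top%O) fU fC joinxC. Qed.

Lemma boolean_homD : {morph f : X Y / (X `\` Y)%O}.
Proof. by have [_ fI fC] := fP; move=> X Y; rewrite !diffE fI fC. Qed.

End BooleanHom.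

Record measured_ba (R : realType) := MeasuredBA {
  ba_disp : Order.disp_t;
  ba_sort :> ctbDistrLatticeType ba_disp;
  mu : ba_sort -> R;
  mu_itv : forall X, 0 <= mu X <= 1;
  muUI : forall X Y, mu (X `|` Y)%O + mu (X `&` Y)%O = mu X + mu Y;
  mu0 : mu \bot%O = 0;
  mu1 : mu \top%O = 1 }.

Record measured_gba (R : realType) (Gam : groupType) := MeasuredGBA {
  gba_mba :> measured_ba R;
  bact : Gam -> gba_mba -> gba_mba;
  bact_hom : forall g, boolean_hom (bact g);
  bact1 : forall X, bact 1%g X = X;
  bactM : forall g h X, bact (g * h)%g X = bact g (bact h X);
  bact_mu : forall g X, mu (bact g X) = mu X }.

Section MeasuredTheory.
Variables (R : realType) (P : measured_ba R).
Implicit Types X Y Z T : P.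

Definition mdist X Y : R := mu (X `|` Y)%O - mu (X `&` Y)%O.

Lemma mu_ge0 X : 0 <= mu X. Proof. by have /andP[] := mu_itv X. Qed.

Lemma mu_disj X Y : (X `&` Y = \bot)%O -> mu (X `|` Y)%O = mu X + mu Y.
Proof. by move=> XY; rewrite -muUI XY mu0 addr0. Qed.

Lemma mu_diff X Y : (X <= Y)%O -> mu Y = mu X + mu (Y `\` X)%O.
Proof.
move=> XY; rewrite -mu_disj; last by rewrite diffKI.
by rewrite joinC diffUK (join_l XY).
Qed.

Lemma mu_le X Y : (X <= Y)%O -> mu X <= mu Y.
Proof. by move=> /mu_diff ->; rewrite lerDl mu_ge0. Qed.

Lemma muU_le X Y : mu (X `|` Y)%O <= mu X + mu Y.
Proof. by rewrite -muUI lerDl mu_ge0. Qed.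

Definition sdiff X Y := ((X `\` Y) `|` (Y `\` X))%O.

Lemma sdiff_le X Y T : (sdiff X Y <= T)%O = (X <= Y `|` T)%O && (Y <= X `|` T)%O.
Proof. by rewrite leUx !leBLR. Qed.

Lemma mdistE X Y : mdist X Y = mu (sdiff X Y).
Proof.
have XYI : (X `&` Y <= X `|` Y)%O by rewrite leIxl// leUl.
rewrite /mdist (mu_diff XYI) addrAC subrr add0r; congr mu.
by rewrite diffUx !diffxI !diffxx join0x joinx0.
Qed.

Lemma mdist_le X Y T : (X <= Y `|` T)%O -> (Y <= X `|` T)%O -> mdist X Y <= mu T.
Proof. by move=> XY YX; rewrite mdistE mu_le// sdiff_le XY. Qed.

Lemma mdist_ge0 X Y : 0 <= mdist X Y.
Proof. by rewrite mdistE mu_ge0. Qed.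

Lemma mdistxx X : mdist X X = 0.
Proof. by rewrite /mdist joinxx meetxx subrr. Qed.

Lemma mdistC X Y : mdist X Y = mdist Y X.
Proof. by rewrite /mdist joinC meetC. Qed.

Let mdistP X Y : exists T, [/\ (X <= Y `|` T)%O, (Y <= X `|` T)%O & mdist X Y = mu T].
Proof.
exists (sdiff X Y); rewrite mdistE.
by have := lexx (sdiff X Y); rewrite {1}sdiff_le => /andP[].
Qed.

Lemma mdist_trans Y X Z : mdist X Z <= mdist X Y + mdist Y Z.
Proof.
have [S [XY YX ->]] := mdistP X Y; have [T [YZ ZY ->]] := mdistP Y Z.
apply: le_trans (muU_le _ _); apply: mdist_le.
  by rewrite (le_trans XY)// [(S `|` T)%O]joinC joinA leU2.
by rewrite (le_trans ZY)// joinA leU2.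
Qed.

Lemma mdistU X X' Y Y' :
  mdist (X `|` Y)%O (X' `|` Y')%O <= mdist X X' + mdist Y Y'.
Proof.
have [S [XX X'X ->]] := mdistP X X'; have [T [YY Y'Y ->]] := mdistP Y Y'.
apply: le_trans (muU_le _ _).
by apply: mdist_le; rewrite joinACA leU2.
Qed.

Lemma mdistI X X' Y Y' :
  mdist (X `&` Y)%O (X' `&` Y')%O <= mdist X X' + mdist Y Y'.
Proof.
have [S [XX X'X ->]] := mdistP X X'; have [T [YY Y'Y ->]] := mdistP Y Y'.
apply: le_trans (muU_le _ _).
have H (U V U' V' : P) : (U <= U' `|` S)%O -> (V <= V' `|` T)%O ->
    (U `&` V <= (U' `&` V') `|` (S `|` T))%O.
  move=> US VT; apply: le_trans (leI2 US VT) _.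
  by rewrite joinIl; apply: leI2; rewrite leU2// (leUl, leUr).
by apply: mdist_le; exact: H.
Qed.

Lemma mdistN X Y : mdist (~` X)%O (~` Y)%O = mdist X Y.
Proof.
rewrite !mdistE; congr mu; rewrite /sdiff !diffE !complK.
by rewrite [(~` X `&` Y)%O]meetC [(~` Y `&` X)%O]meetC joinC.
Qed.

Lemma mu_mdist X Y : `|mu X - mu Y| <= mdist X Y.
Proof.
have [T [XY YX ->]] := mdistP X Y; rewrite ler_norml.
have := le_trans (mu_le XY) (muU_le _ _); have := le_trans (mu_le YX) (muU_le _ _).
by move=> ? ?; apply/andP; split; lra.
Qed.

End MeasuredTheory.

Section Ultralimit.
Context {R : realType} {I : Type} {U : set_system I} {UU : UltraFilter U}.

Lemma ultra_cvg (f : I -> R) : (forall j, 0 <= f j <= 1) -> cvg (f @ U).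
Proof.
move=> f01.
have Uf : U (f @^-1` `[0, 1]%classic).
  by apply: filterE => j; rewrite /preimage set_itvE; exact: f01.
have [l [_ lf]] := @segment_compact R 0 1 (f @ U) _ Uf.
apply/cvg_ex; exists l => N Nl.
have [//|UN] := in_ultra_setVsetC (f @^-1` N) UU.
by have [? []] := lf (~` N) N UN Nl.
Qed.

End Ultralimit.

Section Ultraproduct.
Variables (R : realType) (I : Type) (U : set_system I).
Context {UU : UltraFilter U}.
Variable P : I -> measured_ba R.

Definition prod_family := forall j, P j.
HB.instance Definition _ := Choice.on prod_family.
Implicit Types X Y Z : prod_family.

(* The metric ultraproduct: families modulo lim_U d_j(X_j, Y_j) = 0. *)
Definition ueq X Y : bool := `[< mdist (X j) (Y j) @[j --> U] --> (0 : R) >].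

Lemma ueqP X Y :
  reflect (forall e : R, 0 < e -> \forall j \near U, mdist (X j) (Y j) < e) (ueq X Y).
Proof.
apply: (iffP (asboolP _)) => [/cvgr0Pnorm_lt XY e /XY|XY].
  by apply: filterS => j; rewrite ger0_norm// mdist_ge0.
by apply/cvgr0Pnorm_lt => e /XY; apply: filterS => j; rewrite ger0_norm// mdist_ge0.
Qed.

Lemma ueq_refl : reflexive ueq.
Proof. by move=> X; apply/ueqP => e e0; apply: filterE => j; rewrite mdistxx. Qed.

Lemma ueq_sym : symmetric ueq.
Proof.
move=> X Y; suff H X' Y' : ueq X' Y' -> ueq Y' X' by apply/idP/idP; exact: H.
by move=> /ueqP XY; apply/ueqP => e /XY; apply: filterS => j; rewrite mdistC.
Qed.

Lemma ueq_cong2 X X' Y Y' Z Z' :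
    (forall j, mdist (Z j) (Z' j) <= mdist (X j) (X' j) + mdist (Y j) (Y' j)) ->
  ueq X X' -> ueq Y Y' -> ueq Z Z'.
Proof.
move=> ZXY /ueqP XX /ueqP YY; apply/ueqP => e e0.
have e20 : 0 < e / 2 by rewrite divr_gt0.
apply: filterS2 (XX _ e20) (YY _ e20) => j Xj Yj.
by apply: le_lt_trans (ZXY j) _; rewrite [e]splitr ltrD.
Qed.

Lemma ueq_trans : transitive ueq.
Proof. by move=> Y X Z; apply: ueq_cong2 => j; exact: mdist_trans. Qed.

Canonical ueq_equiv := EquivRel ueq ueq_refl ueq_sym ueq_trans.
Canonical ueq_encModRel := defaultEncModRel ueq.

Definition ultra := {eq_quot ueq}.
HB.instance Definition _ : EqQuotient _ ueq ultra := EqQuotient.on ultra.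
HB.instance Definition _ := Choice.on ultra.

Definition fam_join X Y : prod_family := fun j => (X j `|` Y j)%O.
Definition fam_meet X Y : prod_family := fun j => (X j `&` Y j)%O.
Definition fam_compl X : prod_family := fun j => (~` X j)%O.

Definition ultra_join := lift_op2 ultra fam_join.
Definition ultra_meet := lift_op2 ultra fam_meet.
Definition ultra_compl := lift_op1 ultra fam_compl.
Definition ultra_bot : ultra := \pi_ultra ((fun j => \bot%O) : prod_family).
Definition ultra_top : ultra := \pi_ultra ((fun j => \top%O) : prod_family).

Lemma ueq_repr X : ueq X (repr (\pi_ultra X)).
Proof. by apply/(@eqquotP _ ueq ultra); rewrite reprK. Qed.

Lemma pi_ultra_join : {morph \pi_ultra : X Y / fam_join X Y >-> ultra_join X Y}.
Proof.
move=> X Y; unlock ultra_join; apply/eqquotP.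
by apply: ueq_cong2 (ueq_repr X) (ueq_repr Y) => j; exact: mdistU.
Qed.
Canonical pi_ultra_join_morph := PiMorph2 pi_ultra_join.

Lemma pi_ultra_meet : {morph \pi_ultra : X Y / fam_meet X Y >-> ultra_meet X Y}.
Proof.
move=> X Y; unlock ultra_meet; apply/eqquotP.
by apply: ueq_cong2 (ueq_repr X) (ueq_repr Y) => j; exact: mdistI.
Qed.
Canonical pi_ultra_meet_morph := PiMorph2 pi_ultra_meet.

Lemma pi_ultra_compl : {morph \pi_ultra : X / fam_compl X >-> ultra_compl X}.
Proof.
move=> X; unlock ultra_compl; apply/eqquotP.
by apply: ueq_cong2 (ueq_repr X) (ueq_refl X) => j; rewrite mdistN lerDl mdist_ge0.
Qed.
Canonical pi_ultra_compl_morph := PiMorph1 pi_ultra_compl.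

Let famP X Y : (forall j, X j = Y j) -> X = Y.
Proof. by move=> XY; apply/functional_extensionality_dep. Qed.

Let le x y := ultra_meet x y == x.
Let lt x y := (y != x) && le x y.

Fact ultra_meetC : commutative ultra_meet.
Proof.
elim/quotW => X; elim/quotW => Y; rewrite -!pi_ultra_meet.
by congr (\pi_ultra _); apply/famP => j; exact: meetC.
Qed.
Fact ultra_joinC : commutative ultra_join.
Proof.
elim/quotW => X; elim/quotW => Y; rewrite -!pi_ultra_join.
by congr (\pi_ultra _); apply/famP => j; exact: joinC.
Qed.
Fact ultra_meetA : associative ultra_meet.
Proof.
elim/quotW => X; elim/quotW => Y; elim/quotW => Z; rewrite -!pi_ultra_meet.
by congr (\pi_ultra _); apply/famP => j; exact: meetA.
Qed.
Fact ultra_joinA : associative ultra_join.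
Proof.
elim/quotW => X; elim/quotW => Y; elim/quotW => Z; rewrite -!pi_ultra_join.
by congr (\pi_ultra _); apply/famP => j; exact: joinA.
Qed.
Fact ultra_joinKI y x : ultra_meet x (ultra_join x y) = x.
Proof.
elim/quotW: x => X; elim/quotW: y => Y; rewrite -pi_ultra_join -pi_ultra_meet.
by congr (\pi_ultra _); apply/famP => j; exact: joinKI.
Qed.
Fact ultra_meetKU y x : ultra_join x (ultra_meet x y) = x.
Proof.
elim/quotW: x => X; elim/quotW: y => Y; rewrite -pi_ultra_meet -pi_ultra_join.
by congr (\pi_ultra _); apply/famP => j; exact: meetKU.
Qed.
Fact ultra_meetUl : left_distributive ultra_meet ultra_join.
Proof.
elim/quotW => X; elim/quotW => Y; elim/quotW => Z.
rewrite -!(pi_ultra_join, pi_ultra_meet).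
by congr (\pi_ultra _); apply/famP => j; exact: meetUl.
Qed.
Fact ultra_meetxx : idempotent_op ultra_meet.
Proof.
elim/quotW => X; rewrite -pi_ultra_meet.
by congr (\pi_ultra _); apply/famP => j; exact: meetxx.
Qed.
HB.instance Definition _ :=
  @Order.isMeetJoinDistrLattice.Build (Order.Disp tt tt) ultra le lt
    ultra_meet ultra_join (fun _ _ => erefl) (fun _ _ => erefl)
    ultra_meetC ultra_joinC ultra_meetA ultra_joinA ultra_joinKI ultra_meetKU
    ultra_meetUl ultra_meetxx.

Fact ultra_le0x (x : ultra) : (ultra_bot <= x)%O.
Proof.
elim/quotW: x => X; apply/eqP; rewrite -[LHS]pi_ultra_meet.
by congr (\pi_ultra _); apply/famP => j; exact: meet0x.
Qed.
Fact ultra_lex1 (x : ultra) : (x <= ultra_top)%O.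
Proof.
elim/quotW: x => X; apply/eqP; rewrite -[LHS]pi_ultra_meet.
by congr (\pi_ultra _); apply/famP => j; exact: meetx1.
Qed.
HB.instance Definition _ := @Order.hasBottom.Build _ ultra _ ultra_le0x.
HB.instance Definition _ := @Order.hasTop.Build _ ultra _ ultra_lex1.

Fact ultra_joinxC (x : ultra) : (x `|` ultra_compl x)%O = \top%O.
Proof.
elim/quotW: x => X; rewrite -pi_ultra_compl -[LHS]pi_ultra_join.
by congr (\pi_ultra _); apply/famP => j; exact: joinxC.
Qed.
Fact ultra_meetxC (x : ultra) : (x `&` ultra_compl x)%O = \bot%O.
Proof.
elim/quotW: x => X; rewrite -pi_ultra_compl -[LHS]pi_ultra_meet.
by congr (\pi_ultra _); apply/famP => j; exact: meetxC.
Qed.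
HB.instance Definition _ :=
  @Order.TBDistrLattice_hasComplement.Build _ ultra ultra_compl
    ultra_joinxC ultra_meetxC.

Definition ultra_mu (x : ultra) : R := lim (mu (repr x j) @[j --> U]).

Lemma mu_cvg X : cvg (mu (X j) @[j --> U]).
Proof. by apply: ultra_cvg => j; exact: mu_itv. Qed.

Lemma ultra_mu_pi X : ultra_mu (\pi_ultra X) = lim (mu (X j) @[j --> U]).
Proof.
have /ueqP XY := ueq_repr X; rewrite /ultra_mu.
move: (repr _) XY => Y XY; apply/cvg_lim => //.
apply/cvgrPdist_lt => e e0.
have e20 : 0 < e / 2 by rewrite divr_gt0.
have /cvgrPdist_lt/(_ _ e20) lX :
  mu (X j) @[j --> U] --> lim (mu (X j) @[j --> U]) by exact: mu_cvg.
apply: filterS2 lX (XY _ e20) => j lXj XYj.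
have := mu_mdist (X j) (Y j); set l := lim _ in lXj *.
move=> XYmu; rewrite -(subrKA (mu (X j)) l) [e]splitr.
rewrite (le_lt_trans (ler_normD _ _))// ltrD//; exact: le_lt_trans XYj.
Qed.

Fact ultra_mu_itv x : 0 <= ultra_mu x <= 1.
Proof.
elim/quotW: x => X; rewrite ultra_mu_pi; apply/andP; split.
  by apply: limr_ge; [exact: mu_cvg|apply: filterE => j; exact: mu_ge0].
apply: limr_le; [exact: mu_cvg|apply: filterE => j].
by have /andP[] := mu_itv (X j).
Qed.

Fact ultra_muUI (x y : ultra) :
  ultra_mu (x `|` y)%O + ultra_mu (x `&` y)%O = ultra_mu x + ultra_mu y.
Proof.
elim/quotW: x => X; elim/quotW: y => Y.
rewrite -[(_ `|` _)%O]pi_ultra_join -[(_ `&` _)%O]pi_ultra_meet !ultra_mu_pi.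
rewrite -!limD; do ?exact: mu_cvg.
by congr (lim (_ @ U)); apply: funext => j; exact: muUI.
Qed.

Fact ultra_mu0 : ultra_mu \bot%O = 0.
Proof.
rewrite [LHS]ultra_mu_pi; under eq_fun do rewrite mu0.
exact: lim_cst.
Qed.

Fact ultra_mu1 : ultra_mu \top%O = 1.
Proof.
rewrite [LHS]ultra_mu_pi; under eq_fun do rewrite mu1.
exact: lim_cst.
Qed.

Definition ultraproduct_ba : measured_ba R :=
  MeasuredBA ultra_mu_itv ultra_muUI ultra_mu0 ultra_mu1.

End Ultraproduct.
Arguments ultra {R I} U {UU} P.
Arguments ultraproduct_ba {R I} U {UU} P.

Section UltraproductAction.
Variables (R : realType) (Gam : groupType) (I : Type) (U : set_system I).
Context {UU : UltraFilter U}.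
Variable P : I -> measured_gba R Gam.

Notation uP := (ultra U P).

Definition fam_act (g : Gam) (X : prod_family P) : prod_family P := fun j => bact g (X j).
Definition ultra_act (g : Gam) : uP -> uP := lift_op1 uP (fam_act g).

Lemma pi_ultra_act g : {morph \pi_uP : X / fam_act g X >-> ultra_act g X}.
Proof.
move=> X; unlock ultra_act; apply/eqquotP.
apply: ueq_cong2 (ueq_repr X) (ueq_refl X) => j; rewrite mdistxx addr0.
by have [fU fI _] := bact_hom (P j) g; rewrite /mdist -fU -fI !bact_mu.
Qed.

Let famP (X Y : prod_family P) : (forall j, X j = Y j) -> X = Y.
Proof. by move=> XY; apply/functional_extensionality_dep. Qed.

Fact ultra_act_hom g : @boolean_hom _ _ (ultraproduct_ba U P) (ultraproduct_ba U P) (ultra_act g).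
Proof.
split.
- elim/quotW => X; elim/quotW => Y.
  rewrite -[(_ `|` _)%O]pi_ultra_join -!pi_ultra_act -[RHS]pi_ultra_join.
  by congr (\pi_uP _); apply/famP => j; have [+ _ _] := bact_hom (P j) g; apply.
- elim/quotW => X; elim/quotW => Y.
  rewrite -[(_ `&` _)%O]pi_ultra_meet -!pi_ultra_act -[RHS]pi_ultra_meet.
  by congr (\pi_uP _); apply/famP => j; have [_ + _] := bact_hom (P j) g; apply.
- elim/quotW => X.
  rewrite -[(~` _)%O]pi_ultra_compl -!pi_ultra_act -[RHS]pi_ultra_compl.
  by congr (\pi_uP _); apply/famP => j; have [_ _ +] := bact_hom (P j) g; apply.
Qed.

Fact ultra_act1 (x : uP) : ultra_act 1%g x = x.
Proof.
elim/quotW: x => X; rewrite -pi_ultra_act.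
by congr (\pi_uP _); apply/famP => j; exact: bact1.
Qed.

Fact ultra_actM g h (x : uP) : ultra_act (g * h)%g x = ultra_act g (ultra_act h x).
Proof.
elim/quotW: x => X; rewrite -!pi_ultra_act.
by congr (\pi_uP _); apply/famP => j; exact: bactM.
Qed.

Fact ultra_act_mu g (x : uP) : ultra_mu (ultra_act g x) = ultra_mu x.
Proof.
elim/quotW: x => X; rewrite -pi_ultra_act !ultra_mu_pi.
by congr (lim (_ @ U)); apply: funext => j; exact: bact_mu.
Qed.

Definition ultraproduct : measured_gba R Gam :=
  @MeasuredGBA R Gam (ultraproduct_ba U P) ultra_act
    ultra_act_hom ultra_act1 ultra_actM ultra_act_mu.

End UltraproductAction.
Arguments ultraproduct {R Gam I} U {UU} P.

Definition contained (R : realType) (Gam : groupType) (P Q : measured_gba R Gam) : Prop :=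
  exists f : P -> Q,
    [/\ boolean_hom f, forall g X, f (bact g X) = bact g (f X)
      & forall X, mu (f X) = mu X].

(* U is a non-principal ultrafilter on I, and each factor Q j is in the family F. *)
Definition weakly_contained (R : realType) (Gam : groupType)
    (P : measured_gba R Gam) (F : measured_gba R Gam -> Prop) : Prop :=
  exists (I : Type) (U : set_system I) (UU : UltraFilter U)
      (Q : I -> measured_gba R Gam),
    [/\ forall j, ~ U [set j], forall j, F (Q j) & contained P (ultraproduct U Q)].

Section Tensor.
Variables (d : Order.disp_t) (P : ctbDistrLatticeType d) (A : finZmodType).

(* tensor P A is the group P(A), and tens X a its generator X (x) a. *)
Definition tensor_rel : set {freeg (P * A) / int} :=
  [set r | exists (X Y : P) (a b : A),
    r = << 1 *g (X, a) >> + << 1 *g (Y, b) >>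
      - (<< 1 *g ((X `\` Y)%O, a) >> + << 1 *g ((Y `\` X)%O, b) >>
         + << 1 *g ((X `&` Y)%O, a + b) >>)].

Definition tensor : zmodType := presented tensor_rel.
Definition tens (X : P) (a : A) : tensor := pgen tensor_rel (X, a).

Lemma tens_relE X Y a b :
  tens X a + tens Y b =
  tens (X `\` Y)%O a + tens (Y `\` X)%O b + tens (X `&` Y)%O (a + b).
Proof.
apply/eqP; rewrite -subr_eq0 /tens /pgen -!raddfD -raddfB; apply/eqP/pi_rel.
by exists X, Y, a, b.
Qed.

Lemma tensor_rel_lift (M : zmodType) (f : P * A -> M) :
    (forall X Y a b, f (X, a) + f (Y, b) =
      f ((X `\` Y)%O, a) + f ((Y `\` X)%O, b) + f ((X `&` Y)%O, a + b)) ->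
  forall r, tensor_rel r -> fglift (f : P * A -> zmodule M) r = 0.
Proof.
move=> fE _ [X [Y [a [b ->]]]].
pose F_add := GRing.isZmodMorphism.Build _ _ _ (lift_is_additive (f : P * A -> zmodule M)).
pose F : {additive _ -> zmodule M} := HB.pack (fglift (f : P * A -> zmodule M)) F_add.
rewrite -[fglift _]/(F : _ -> _) raddfB !raddfD /= !liftU !scale1r.
by have /eqP := fE X Y a b; rewrite -subr_eq0 !opprD => /eqP.
Qed.

Definition disjoint_family (X : A -> P) : Prop :=
  forall a b, a != 0 -> b != 0 -> a != b -> (X a `&` X b = \bot)%O.

(* Only the values of X at a != 0 matter; they exist and are unique, see
   normal_form_exists and normal_form_unique. *)
Definition normal_form (x : tensor) : set (A -> P) :=
  [set X | disjoint_family X /\ x = \sum_(a | a != 0) tens (X a) a].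

End Tensor.

Section NormalForm.
Variables (d : Order.disp_t) (P : ctbDistrLatticeType d) (A : finZmodType).
Local Notation tensor := (tensor P A).
Implicit Types (X Y Z : P) (a b c : A).
Local Notation "X `|` Y" := (Order.join X Y).
Local Notation "X `&` Y" := (Order.meet X Y).
Local Notation "X `\` Y" := (Order.diff X Y).
Local Notation "~` X" := (Order.compl X).
Local Notation bot := (\bot%O : P).

Lemma tens_bot a : tens bot a = 0 :> tensor.
Proof.
have := @tens_relE _ P A bot bot a 0; rewrite diffxx meetxx addr0.
by rewrite -[LHS]addr0 => /addrI.
Qed.

Lemma tensD X a b : tens X (a + b) = tens X a + tens X b :> tensor.
Proof. by rewrite tens_relE diffxx meetxx !tens_bot !add0r. Qed.

Lemma tens0 X : tens X (0 : A) = 0 :> tensor.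
Proof. by apply: (@addrI _ (tens X 0)); rewrite -tensD !addr0. Qed.

Lemma tensN X a : tens X (- a) = - tens X a :> tensor.
Proof. by apply/eqP; rewrite -addr_eq0 -tensD addNr tens0. Qed.

Lemma tensU X Y a : X `&` Y = bot -> tens (X `|` Y) a = tens X a + tens Y a :> tensor.
Proof.
move=> XY; apply/eqP; rewrite -subr_eq -tensN tens_relE joinBK addrN tens0 addr0.
have -> : Y `\` (X `|` Y) = bot by apply/eqP; rewrite diff_eq0 leUr.
by rewrite tens_bot addr0 disj_diffl// XY.
Qed.

Let splits (X : A -> P) :=
  forall Y b, tens Y b = \sum_a tens (Y `&` X a) b :> tensor.

Let disj_all (X : A -> P) := forall a b, a != b -> X a `&` X b = bot.

Let add_tens (X : A -> P) Y b : disj_all X -> splits X ->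
  exists Z : A -> P, [/\ disj_all Z, splits Z &
    \sum_a tens (Z a) a = \sum_a tens (X a) a + tens Y b :> tensor].
Proof.
move=> Xd Xs; pose Z c := (X c `\` Y) `|` (X (c - b) `&` Y).
have dY U V : (U `\` Y) `&` (V `&` Y) = bot.
  by rewrite meetC -meetA [Y `&` _]meetC diffIK meetx0.
have dY' U V W : (W `&` (U `\` Y)) `&` (W `&` (V `&` Y)) = bot.
  by rewrite meetACA dY meetx0.
have sh (F : A -> tensor) : \sum_c F (c - b) = \sum_c F c.
  rewrite [RHS](reindex_inj (addIr (- b))) /=; exact: eq_bigr.
exists Z; split.
- move=> a c ac; rewrite /Z meetUl !meetUr dY joinx0.
  rewrite [(X (a - b) `&` Y) `&` (_ `\` _)]meetC dY join0x.
  rewrite meetACA meetxx [X (a - b) `&` _]Xd ?meet0x ?joinx0; last first.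
    by rewrite (inj_eq (addIr _)).
  by rewrite meetBx meetxB Xd// !diff0x.
- move=> Y' b'; rewrite /Z.
  under eq_bigr do rewrite meetUr tensU ?dY'//.
  rewrite big_split /= (sh (fun c => tens (Y' `&` (X c `&` Y)) b')).
  have -> : tens Y' b' = tens (Y' `\` Y) b' + tens (Y' `&` Y) b' :> tensor.
    by rewrite -tensU ?joinBI// -[Y' `&` Y]meetC meetA diffIK meet0x.
  rewrite Xs (Xs (Y' `&` Y)); congr (_ + _); apply: eq_bigr => c _; congr tens.
    by rewrite meetxB meetBx.
  by rewrite -meetA [Y `&` _]meetC.
rewrite /Z (Xs Y b); under eq_bigr do rewrite tensU//.
rewrite big_split /=.
have -> : \sum_c tens (X (c - b) `&` Y) c = \sum_c tens (X c `&` Y) (c + b) :> tensor.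
  rewrite -(sh (fun c => tens (X c `&` Y) (c + b))).
  by apply: eq_bigr => c _; rewrite subrK.
rewrite -!big_split; apply: eq_bigr => c _ /=.
rewrite tensD addrA -tensU ?joinBI; first by rewrite [Y `&` _]meetC.
by rewrite meetC -meetA [Y `&` _]meetC diffIK meetx0.
Qed.

Lemma normal_form_exists (x : tensor) : normal_form x !=set0.
Proof.
pose N (x : tensor) := exists X : A -> P, [/\ disj_all X, splits X & x = \sum_a tens (X a) a].
suff [X [Xd _ ->]] : N x.
  exists X; split=> [a b _ _|]; first exact: Xd.
  by rewrite (bigD1 0)//= tens0 add0r.
suff NN y : forall x, N x -> N (x + y) /\ N (x - y).
  have N0 : N 0.
    exists (fun a => if a == 0 then \top%O else bot); split.
    - move=> a b; case: (eqVneq a 0) => [->|_ _]; last by rewrite meet0x.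
      by rewrite eq_sym => /negPf ->; rewrite meetx0.
    - move=> Y b; rewrite (bigD1 0)//= eqxx meetx1 big1 ?addr0// => a /negPf ->.
      by rewrite meetx0 tens_bot.
    - rewrite big1// => a _; case: eqVneq => [->|_]; first exact: tens0.
      exact: tens_bot.
  by have [+ _] := NN x _ N0; rewrite add0r.
move: y; apply: presented_ind => [x' Nx|x1 x2 N1 N2 x' Nx|[Y b] x' [X [Xd Xs ->]]].
- by rewrite subr0 addr0.
- by split; [rewrite addrA; apply: (N2 _ _).2; apply: (N1 _ _).1
            |rewrite opprB addrA; apply: (N1 _ _).2; apply: (N2 _ _).1].
- split.
  by have [Z [Zd Zs ZE]] := add_tens Y b Xd Xs; exists Z.
have [Z [Zd Zs ZE]] := add_tens Y (- b) Xd Xs; exists Z; split=> //.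
by rewrite ZE tensN.
Qed.

(* Towards uniqueness: a two-valued homomorphism h with h Z for Z != 0, obtained
   from an ultrafilter on the set P containing all the sets dec Z l. *)
Let dec (Z : P) (l : seq P) : set P :=
  [set Y | [/\ Y != bot, (Y <= Z)%O & forall X, X \in l -> (Y <= X)%O \/ (Y <= ~` X)%O]].

Let dec_neq0 Z l : Z != bot -> dec Z l !=set0.
Proof.
move=> Z0; elim: l => [|X l [Y [Y0 YZ Yl]]]; first by exists Z; split.
have [YX|YX] := eqVneq (Y `&` X) bot.
  exists Y; split=> // X'; rewrite inE => /orP[/eqP->|]; last exact: Yl.
  by right; rewrite -disj_leC YX.
exists (Y `&` X); split=> //; first by rewrite leIxl.
move=> X'; rewrite inE => /orP[/eqP->|/Yl[YX'|YX']].
- by left; exact: leIr.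
- by left; rewrite leIxl.
- by right; rewrite leIxl.
Qed.

Lemma boolean_point Z : Z != bot ->
  exists h : P -> bool, [/\ h Z, forall X Y, h (X `&` Y) = h X && h Y
    & forall X, h (~` X) = ~~ h X].
Proof.
move=> Z0.
have FF : ProperFilter (filter_from [set: seq P] (dec Z)).
  apply: filter_from_proper => [|l _]; last exact: dec_neq0.
  apply: filter_from_filter; first by exists [::].
  move=> l l' _ _; exists (l ++ l') => // Y [Y0 YZ Yl].
  by split; split=> // X Xl; apply: Yl; rewrite mem_cat Xl ?orbT.
have [G [GU FG]] := ultraFilterLemma FF.
pose S X : set P := [set Y | Y != bot /\ (Y <= X)%O].
have GC X : G (S X) \/ G (S (~` X)).
  have [|GN] := in_ultra_setVsetC (S X) GU; [by left|right].
  have GX : G (dec Z [:: X]) by apply: FG; exists [:: X].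
  apply: filterS2 GN GX => Y /= NY [Y0 _ /(_ X)].
  by rewrite mem_head => -[//|YX|YX]; [case: NY|].
have GI X Y : G (S (X `&` Y)) <-> G (S X) /\ G (S Y).
  split=> [GXY|[]]; first by split; apply: filterS GXY => V [V0]; rewrite lexI => /andP[].
  by apply: filterS2 => V [V0 VX] [_ VY]; split=> //; rewrite lexI VX.
have Gbot : ~ G (S bot).
  by move=> /filter_ex[V [/negP V0]]; rewrite lex0.
exists (fun X => `[< G (S X) >]); split.
- by apply/asboolP; apply: FG; exists [::] => // Y [Y0 YZ _].
- move=> X Y; apply/asboolP/andP => [/GI[GX GY]|[/asboolP GX /asboolP GY]].
    by split; apply/asboolP.
  exact/GI.
move=> X; apply/asboolP/idP => [GN|].
  by apply/negP => /asboolP GX; apply: Gbot; rewrite -(meetxC X); exact/GI.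
by move=> /asboolP GX; have [] := GC X.
Qed.

Lemma normal_form_unique (x : tensor) (X Y : A -> P) :
  normal_form x X -> normal_form x Y -> forall a, a != 0 -> X a = Y a.
Proof.
suff H (X' Y' : A -> P) a : normal_form x X' -> normal_form x Y' -> a != 0 -> (X' a <= Y' a)%O.
  by move=> xX xY a a0; apply/le_anti; rewrite !H.
move=> [Xd xX] [Yd xY] a0; rewrite -diff_eq0; apply/negPn/negP => /boolean_point.
move=> [h [hZ hI hC]].
have hbot : h bot = false by rewrite -(meetxC bot) hI hC andbN.
pose ev := plift (fun Va : P * A => if h Va.1 then Va.2 else 0) : tensor -> A.
have ev_rel r : tensor_rel r ->
    fglift ((fun Va => if h Va.1 then Va.2 else 0) : P * A -> zmodule A) r = 0.
  apply: tensor_rel_lift => V W b c /=; rewrite !diffE !hI !hC.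
  by case: (h V); case: (h W); rewrite /= ?addr0 ?add0r.
pose ev_add := GRing.isZmodMorphism.Build _ _ _ (plift_additive ev_rel).
pose evA : {additive tensor -> A} := HB.pack ev ev_add.
have evE V : disjoint_family V -> forall b, b != 0 -> h (V b) ->
    evA (\sum_(c | c != 0) tens (V c) c) = b.
  move=> Vd b b0 hb; rewrite raddf_sum (bigD1 b)//= big1 ?addr0 => [|c /andP[c0 cb]].
    by rewrite /ev plift_pgen//= hb.
  rewrite /ev plift_pgen//=; case: ifP => // hc.
  by have := hI (V c) (V b); rewrite (Vd c b)// hbot hb hc.
have [hX hY] : h (X' a) /\ ~~ h (Y' a) by apply/andP; rewrite -hC -hI -diffE.
have := evE _ Xd _ a0 hX; rewrite -xX xY => ea.
have [/existsP[b /andP[b0 hb]]|/existsPn hN] := boolP [exists b, (b != 0) && h (Y' b)].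
  by move: hY; rewrite -ea (evE _ Yd b)// hb.
move: a0; rewrite -ea raddf_sum big1 ?eqxx// => b b0.
by have := hN b; rewrite b0 /= /ev plift_pgen//= => /negPf ->.
Qed.

End NormalForm.

(* mu(x) = sum_{a != 0} mu(X_a), for the normal form X of x. *)
Definition tensor_mu (R : realType) (P : measured_ba R) (A : finZmodType)
    (x : tensor P A) : R :=
  \sum_(a | a != 0) mu (xget (fun=> \bot%O) (normal_form x) a).

Lemma tensor_mu_normal_form (R : realType) (P : measured_ba R) (A : finZmodType)
    (x : tensor P A) (X : A -> P) :
  normal_form x X -> tensor_mu x = \sum_(a | a != 0) mu (X a).
Proof.
move=> xX; apply: eq_bigr => a a0; congr mu.
exact: normal_form_unique (xgetPex _ (normal_form_exists x)) xX a a0.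
Qed.

Section TensorMap.
Variables (d d' : Order.disp_t).
Variables (P : ctbDistrLatticeType d) (Q : ctbDistrLatticeType d').
Variables (A : finZmodType) (f : P -> Q).

Definition tensor_map : tensor P A -> tensor Q A :=
  plift (fun Xa : P * A => tens (f Xa.1) Xa.2).

Hypothesis fP : boolean_hom f.

Fact tensor_map_rel r : tensor_rel r ->
  fglift ((fun Xa => tens (f Xa.1) Xa.2) : P * A -> zmodule (tensor Q A)) r = 0.
Proof.
have [_ fI _] := fP; apply: tensor_rel_lift => X Y a b /=.
by rewrite !(boolean_homD fP) fI -tens_relE.
Qed.

Lemma tensor_mapB : zmod_morphism tensor_map.
Proof. exact/plift_additive/tensor_map_rel. Qed.

Lemma tensor_map_tens X a : tensor_map (tens X a) = tens (f X) a.
Proof. exact/(plift_pgen tensor_map_rel). Qed.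

End TensorMap.

Section GammaTensor.
Variables (R : realType) (Gam : groupType) (P : measured_gba R Gam) (A : finZmodType).

Definition tensor_act (g : Gam) : tensor P A -> tensor P A := tensor_map (bact g).

Fact tensor_actB g : zmod_morphism (tensor_act g).
Proof. exact/tensor_mapB/bact_hom. Qed.

Lemma tensor_act_tens g X a : tensor_act g (tens X a) = tens (bact g X) a.
Proof. exact/tensor_map_tens/bact_hom. Qed.

Fact tensor_act1 x : tensor_act 1%g x = x.
Proof.
move: x; apply: presented_eq => //; first exact: tensor_actB.
by move=> [X a]; rewrite -[pgen _ _]/(tens X a) tensor_act_tens bact1.
Qed.

Fact tensor_actM g h x : tensor_act (g * h)%g x = tensor_act g (tensor_act h x).
Proof.
move: x; apply: presented_eq => //; first exact: tensor_actB.
  by move=> x y; rewrite !tensor_actB.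
by move=> [X a]; rewrite -[pgen _ _]/(tens X a) !tensor_act_tens bactM.
Qed.

Definition tensor_module : gmodule Gam := GModule tensor_actB tensor_act1 tensor_actM.

Definition trivial_module : gmodule Gam :=
  @GModule Gam A (fun _ a => a) (fun _ _ _ => erefl) (fun _ => erefl) (fun _ _ _ => erefl).

Fact theta_subproof :
  is_ghomb ((fun a => tens \top%O a) : trivial_module -> tensor_module).
Proof.
apply/asboolP; split=> [a b|g a] /=.
  by apply/eqP; rewrite eq_sym subr_eq -tensD subrK.
by rewrite tensor_act_tens boolean_hom1//; exact: bact_hom.
Qed.

Definition theta : ghom trivial_module tensor_module := Ghom theta_subproof.

End GammaTensor.

Section Realization.
Variables (R : realType) (K : simplicial_complex).

(* Points of |K| in barycentric coordinates. *)
Definition is_real_point (x : vertex K -> R) : bool :=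
  `[< exists2 s : {fset vertex K}, s \in simplices K &
      [/\ forall v, 0 <= x v, forall v, v \notin s -> x v = 0
        & \sum_(v <- s) x v = 1] >].

Record realization := RealPoint {
  real_point :> vertex K -> R;
  real_pointP : is_real_point real_point }.
HB.instance Definition _ := [isSub for real_point].
HB.instance Definition _ := [Choice of realization by <:].

Definition face (s : {fset vertex K}) : set realization :=
  [set x | forall v, v \notin s -> x v = 0].

(* The weak (coherent) topology of |K|: W is open iff its trace on each closed
   simplex is; on a closed simplex, where all but finitely many coordinates vanish,
   the pointwise topology is the Euclidean one. *)
Definition weak_open (W : set realization) : Prop :=
  forall s, s \in simplices K ->
    exists2 O : set {ptws vertex K -> R}, open O &
      W `&` face s = real_point @^-1` O `&` face s.

Fact weak_openT : weak_open setT.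
Proof. by move=> s sK; exists setT; [exact: openT|rewrite preimage_setT]. Qed.

Fact weak_openI : setI_closed weak_open.
Proof.
move=> V W oV oW s sK; have [B oB VO] := oV s sK; have [B' oB' WO'] := oW s sK.
exists (B `&` B'); first exact: openI.
by rewrite preimage_setI setIIl VO WO' -setIIl.
Qed.

Fact weak_open_bigU (J : Type) (V : J -> set realization) :
  (forall j, weak_open (V j)) -> weak_open (\bigcup_j V j).
Proof.
move=> oV s sK; have /choice [B BP] : forall j, exists O : set {ptws vertex K -> R},
    open O /\ V j `&` face s = real_point @^-1` O `&` face s.
  by move=> j; have [B oB VO] := oV j s sK; exists B.
exists (\bigcup_j B j); first by apply: bigcup_open => j _; have [] := BP j.
rewrite preimage_bigcup !setI_bigcupl.
by apply: eq_bigcupr => j _; have [] := BP j.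
Qed.

HB.instance Definition _ :=
  isOpenTopological.Build realization weak_openT weak_openI weak_open_bigU.

End Realization.

Definition contractible (R : realType) (T : topologicalType) : Prop :=
  exists (t0 : T) (H : T * R -> T),
    [/\ {within setT `*` `[0, 1], continuous H},
        forall t, H (t, 0) = t & forall t, H (t, 1) = t0].

Section Orbits.
Variables (Gam : groupType) (E : gcomplex Gam) (n : nat).

(* Gam-orbits of unordered n-simplices, i.e. the n-simplices of E/Gam; repr picks
   a lift, together with some ordering of its vertices. *)
Definition same_orbit (x y : osimplex E n) : bool :=
  `[< exists g : Gam, osupport y = [fset vact g v | v in osupport x]%fset >].

Let actK g (s t : {fset vertex E}) : t = [fset vact g v | v in s]%fset ->
  s = [fset vact g^-1%g v | v in t]%fset.
Proof.
move=> ->; apply/fsetP => v; apply/idP/imfsetP => [vs|[_ /imfsetP[w ws ->] ->]].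
  by exists (vact g v); rewrite -?vactM ?mulVg ?vact1// in_imfset.
by rewrite -vactM mulVg vact1.
Qed.

Fact same_orbit_refl : reflexive same_orbit.
Proof.
move=> x; apply/asboolP; exists 1%g; apply/fsetP => v.
apply/idP/imfsetP => [vx|[w wx ->]]; last by rewrite vact1.
by exists v; rewrite ?vact1.
Qed.

Fact same_orbit_sym : symmetric same_orbit.
Proof.
move=> x y; apply/idP/idP => /asboolP[g /actK xy]; apply/asboolP.
  by exists g^-1%g.
by exists g^-1%g.
Qed.

Fact same_orbit_trans : transitive same_orbit.
Proof.
move=> y x z /asboolP[g xy] /asboolP[h yz]; apply/asboolP; exists (h * g)%g.
rewrite yz xy; apply/fsetP => v; apply/imfsetP/imfsetP.
  by move=> [_ /imfsetP[w wx ->] ->]; exists w; rewrite ?vactM.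
by move=> [w wx ->]; exists (vact g w); rewrite ?vactM// in_imfset.
Qed.

Canonical same_orbit_equiv :=
  EquivRel same_orbit same_orbit_refl same_orbit_sym same_orbit_trans.

Definition quotient_simplex := {eq_quot same_orbit}.
HB.instance Definition _ := EqQuotient.on quotient_simplex.
HB.instance Definition _ := Choice.on quotient_simplex.

End Orbits.

(* E contractible, with E/Gam having finitely many simplices in all dimensions
   together. *)
Record finite_type_model (R : realType) (Gam : groupType) := FiniteTypeModel {
  ftm_complex :> gcomplex Gam;
  ftm_contractible : contractible R (realization R ftm_complex);
  ftm_finite : forall n, finite_set [set: quotient_simplex ftm_complex n];
  ftm_dim : exists N, forall n, (N <= n)%N ->
    [set: quotient_simplex ftm_complex n] = set0 }.

(* There is no probability measure on the empty set of n-simplices for n above the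
   dimension, whence the hypothesis of proba_sum. *)
Record faithful_probas (R : realType) (Gam : groupType) (E : gcomplex Gam) :=
  FaithfulProbas {
    proba :> forall n, quotient_simplex E n -> R;
    proba_gt0 : forall n x, 0 < proba (n := n) x;
    proba_sum : forall n, [set: quotient_simplex E n] !=set0 ->
      \sum_(x \in [set: quotient_simplex E n]) proba x = 1 }.

Section Norms.
Variables (R : realType) (Gam : groupType) (E : finite_type_model R Gam).
Variables (nu : faithful_probas R E).
Variables (P : measured_gba R Gam) (A : finZmodType) (n : nat).

(* Neither the lift nor the orientation matters, since c is equivariant, the action
   preserves mu, and mu (- x) = mu x. *)
Definition cochain_norm (c : cochain E n (tensor_module P A)) : R :=
  \sum_(x \in [set: quotient_simplex E n])
    tensor_mu (c (chain_gen (repr x))) * nu n x.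

Definition class_norm (b : cohomology E n (tensor_module P A)) : R :=
  inf [set cochain_norm c | c in [set c : cocycle E n (tensor_module P A) | coclass c = b]].

End Norms.

Definition theta_star (R : realType) (Gam : groupType) (E : gcomplex Gam) (n : nat)
    (P : measured_gba R Gam) (A : finZmodType) :
  cohomology E n (trivial_module Gam A) -> cohomology E n (tensor_module P A) :=
  cohomology_map (theta P A).

(* Main.v *)
Require Import Defs.
From HB Require Import structures.
From mathcomp Require Import all_boot all_order all_algebra perm finmap.
From mathcomp Require Import all_classical all_reals all_analysis.

Set Implicit Arguments.
Unset Strict Implicit.
Unset Printing Implicit Defensive.

Import Order.Theory GRing.Theory Num.Theory.
Import numFieldNormedType.Exports.
Local Open Scope classical_set_scope.
Local Open Scope ring_scope.

(** The norms of the classes theta_*(alpha) are semicontinuous under weak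
    containment: if P embeds in an ultraproduct Q_U of algebras Q_j, then for every
    e > 0 some Q_j satisfies |||theta^{Q_j}_* alpha||| < |||theta^P_* alpha||| + e
    (class_norm_weakly_contained), which contradicts the assumed gap.

    The reason is that an almost optimal cocycle c representing theta^P_* alpha can
    be transported to the Q_j. Its image in Q_U has the same norm, because a
    measure-preserving homomorphism carries the normal form of an element of P(A) to
    a normal form (normal_form_map). To descend from Q_U to the factors one uses the
    full product D of the Q_j, measured through the projection D -> Q_U
    (product_gba). This projection is surjective and measure preserving, while the
    coordinate maps D -> Q_j are homomorphisms whose measures converge along U to
    that of D.

    The only difficulty is that the lift to D must again be a cocycle, in the class
    theta^D_* alpha. It is not the cocycle itself that is lifted but its difference
    from a cocycle theta(a): this difference is a coboundary delta b', and b' lifts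
    since the chain groups of a free Gam-complex are free Z[Gam]-modules
    (cochain_lift, cocycle_lift). The coordinates of the lifted cocycle represent
    theta^{Q_j}_* alpha, and their norms converge to that of c: there are finitely
    many simplices modulo Gam, and normal forms in D are computed coordinatewise
    (cvg_cochain_norm_eval). *)

(** * Equivariant homomorphisms *)

Section ModuleMorphisms.
Variable Gam : groupType.
Implicit Types M N : gmodule Gam.

Lemma gactMz M (g : Gam) (v : M) z : gact g (v *~ z) = gact g v *~ z.
Proof.
pose g_add := GRing.isZmodMorphism.Build _ _ _ (@gactB _ M g).
pose ga : {additive M -> M} := HB.pack (@gact _ M g) g_add.
exact: (raddfMz ga).
Qed.

Lemma ghomD M N (f : ghom M N) v w : f (v + w) = f v + f w.
Proof.
pose f_add := GRing.isZmodMorphism.Build _ _ _ (ghomP f).1.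
pose fa : {additive M -> N} := HB.pack (f : M -> N) f_add.
exact: (raddfD fa).
Qed.

Lemma ghomMz M N (f : ghom M N) v z : f (v *~ z) = f v *~ z.
Proof.
pose f_add := GRing.isZmodMorphism.Build _ _ _ (ghomP f).1.
pose fa : {additive M -> N} := HB.pack (f : M -> N) f_add.
exact: (raddfMz fa).
Qed.

End ModuleMorphisms.

(** * Oriented chains are free over Z[Gam] *)

Section Projectivity.
Variables (Gam : groupType) (E : gcomplex Gam) (n : nat).
Local Notation quot := (quotient_simplex E n).
Implicit Types (x y : osimplex E n) (g h : Gam) (s t : 'S_n.+1).

Lemma operm_operm s t x : operm t (operm s x) = operm (t * s)%g x.
Proof. by apply/val_inj/ffunP => i; rewrite !ffunE permM. Qed.

Lemma oact_oact g h x : oact h (oact g x) = oact (h * g)%g x.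
Proof. by apply/val_inj/ffunP => i; rewrite !ffunE vactM. Qed.

Lemma oact_operm g s x : oact g (operm s x) = operm s (oact g x).
Proof. by apply/val_inj/ffunP => i; rewrite !ffunE. Qed.

Lemma osupport_operm s x : osupport (operm s x) = osupport x.
Proof.
apply/fsetP => v; apply/imfsetP/imfsetP => -[i _ ->].
  by exists (s i); rewrite ?ffunE.
by exists (s^-1%g i); rewrite ?ffunE ?permKV.
Qed.

Lemma osupport_oact g x : osupport (oact g x) = [fset vact g v | v in osupport x]%fset.
Proof.
apply/fsetP => v; apply/imfsetP/imfsetP => [[i _ ->]|[_ /imfsetP[i _ ->] ->]].
  by exists (x i); rewrite ?ffunE//; apply/imfsetP; exists i.
by exists i; rewrite ?ffunE.
Qed.

Lemma operm_of_osupport x y : osupport x = osupport y -> exists s, x = operm s y.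
Proof.
move=> xy; have /andP[/injectiveP x_inj _] := osimplexP x.
have /choice [f fP] i : exists j, x i = y j.
  have : x i \in osupport y by rewrite -xy; apply/imfsetP; exists i.
  by move=> /imfsetP[j _ ->]; exists j.
have f_inj : injective f by move=> i j fij; apply: x_inj; rewrite !fP fij.
by exists (perm f_inj); apply/val_inj/ffunP => i; rewrite ffunE permE -fP.
Qed.

Lemma osimplex_orbit x : exists g s, x = operm s (oact g (repr (\pi_quot x)%qT)).
Proof.
have /asboolP[g xg] : same_orbit (repr (\pi_quot x)%qT) x.
  by apply/(@eqquotP _ (same_orbit_equiv E n) quot); rewrite reprK.
have /operm_of_osupport[s xs] : osupport x = osupport (oact g (repr (\pi_quot x)%qT)).
  by rewrite osupport_oact.
by exists g, s.
Qed.

Lemma pi_operm_oact s g x : (\pi_quot (operm s (oact g x)))%qT = (\pi_quot x)%qT.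
Proof.
apply/esym/eqquotP/asboolP; exists g.
by rewrite osupport_operm osupport_oact.
Qed.

(** The group acts freely on unordered simplices, so g is determined by the vertex
    set of the simplex; then s is determined by the ordering. Together with
    osimplex_orbit, this says that the orbit representatives form a Z[Gam]-basis
    of the oriented chains. *)
Lemma operm_oact_inj s t g h x :
  operm s (oact g x) = operm t (oact h x) -> g = h /\ s = t.
Proof.
move=> sgth; have /andP[/injectiveP x_inj xE] := osimplexP x.
have gh : g = h.
  apply/eqP; rewrite -(can_eq (mulKg h^-1%g)) mulVg; apply/eqP.
  apply: (@vact_free _ E _ (osupport x)) => //.
  have := congr1 (@osupport _ E n) sgth; rewrite !osupport_operm => gh.
  rewrite -osupport_oact -oact_oact osupport_oact gh -osupport_oact oact_oact mulVg.
  by congr osupport; apply/val_inj/ffunP => i; rewrite ffunE vact1.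
split=> //; subst h; apply/permP => i.
have /ffunP/(_ i) := congr1 (@overt _ E n) sgth.
by rewrite !ffunE => /vact_inj/x_inj.
Qed.

(** Projectivity of the chain modules: a cochain is determined by its values on the
    representatives of the orbits of simplices, and these values may be chosen
    freely. *)
Lemma cochain_lift (M N : gmodule Gam) (f : ghom M N) (c : cochain E n N) :
  (forall w, exists v, f v = w) -> exists b : cochain E n M, gcomp f b = c.
Proof.
move=> f_surj; have [fB fJ] := ghomP f; have [cB cJ] := ghomP c.
have /choice [m mP] (q : quot) := f_surj (c (chain_gen (repr q))).
have /choice [G GP] x : exists gs : Gam * 'S_n.+1,
    x = operm gs.2 (oact gs.1 (repr (\pi_quot x)%qT)).
  by have [g [s ->]] := osimplex_orbit x; exists (g, s); rewrite pi_operm_oact reprK.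
pose b0 x : M := gact (G x).1 (m (\pi_quot x)%qT) *~ (-1) ^+ (G x).2.
(* The pair chosen by G is the given one, so the arbitrary choice disappears. *)
have b0E (q : quot) g s : b0 (operm s (oact g (repr q))) = gact g (m q) *~ (-1) ^+ s.
  have := GP (operm s (oact g (repr q))); rewrite /b0 pi_operm_oact reprK.
  by case: (G _) => g' s' /= /operm_oact_inj[-> ->].
have b0_perm x s : b0 (operm s x) = b0 x *~ (-1) ^+ s.
  rewrite [x]GP operm_operm !b0E odd_permM signr_addb -mulrzA.
  by rewrite mulrC.
have b0_act g x : b0 (oact g x) = gact g (b0 x).
  by rewrite [x]GP oact_operm oact_oact !b0E gactMz gactM.
have b0_rel := orient_rel_lift b0_perm.
have bB : zmod_morphism (plift b0 : chain E n -> M) := plift_additive b0_rel.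
have bE x : plift b0 (chain_gen x) = b0 x := plift_pgen b0_rel x.
have bP : is_ghomb (plift b0 : chain E n -> M).
  apply/asboolP; split=> // g; apply: presented_eq => [v w|v w|x].
  - by rewrite gactB bB.
  - by rewrite bB gactB.
  - by rewrite -[pgen _ _]/(chain_gen x) /= chain_act_gen !bE b0_act.
exists (Ghom bP); apply/val_inj/funext => /=; apply: presented_eq => [v w|//|x].
  by rewrite /= bB fB.
rewrite -[pgen _ _]/(chain_gen x) /= bE [x]GP b0E ghomMz fJ mP.
by rewrite chain_gen_perm ghomMz -cJ /= chain_act_gen.
Qed.

End Projectivity.

(** * Lifting cocycles within a cohomology class *)

Section CocycleLift.
Variables (Gam : groupType) (E : gcomplex Gam).

Lemma coclass_eq n (M : gmodule Gam) (c d : cocycle E n M) :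
  coclass c = coclass d <-> c - d \in @is_coboundary _ E n M.
Proof. by rewrite Quotient.idealrBE; split=> [/eqP|/eqP]. Qed.

Lemma coboundary_is_cocycle n (M : gmodule Gam) (b : cochain E n M) :
  is_cocycle (coboundary b).
Proof.
apply/eqP/val_inj/funext => x /=.
rewrite -[boundary_fun _]/(chain_boundary E n (chain_boundary E n.+1 x)) boundaryK.
by rewrite -(subrr 0) (ghomP b).1 !subrr.
Qed.

(** A lift of the cochain d itself need not be a cocycle. Here d differs from the
    image of c by a coboundary, and it suffices to lift a primitive of the latter.
    In degree 0, where coboundaries vanish, d is the image of c. *)
Lemma cocycle_lift n (M N : gmodule Gam) (f : ghom M N)
    (c : cocycle E n M) (d : cocycle E n N) :
    (forall w, exists v, f v = w) -> coclass d = coclass (cocycle_map f c) ->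
  exists2 c' : cocycle E n M, coclass c' = coclass c & cocycle_map f c' = d.
Proof.
move=> f_surj /coclass_eq; rewrite unfold_in.
case: n c d => [|n] c d /=.
  by rewrite subr_eq0 => /eqP ->; exists c.
move=> /asboolP[b' b'E]; have [b bE] := cochain_lift b' f_surj.
pose db : cocycle E n.+1 M := Cocycle (coboundary_is_cocycle b).
exists (c + db).
  by apply/coclass_eq; rewrite addrAC subrr add0r; apply/asboolP; exists b.
have {}b'E : cocycle_cochain d = cocycle_cochain (cocycle_map f c) + coboundary b'.
  by apply/eqP; rewrite addrC -subr_eq; apply/eqP.
apply/val_inj; rewrite /= b'E -bE; apply/val_inj/funext => x.
exact: ghomD.
Qed.

End CocycleLift.

(** * Functoriality of P(A) and of the norms *)

Section TensorFunctoriality.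
Variables (d d' : Order.disp_t) (P : ctbDistrLatticeType d) (Q : ctbDistrLatticeType d').
Variables (A : finZmodType) (f : P -> Q).
Hypothesis fP : boolean_hom f.

(** Boolean homomorphisms preserve disjointness. This is what makes the measure on
    P(A) natural, and computable coordinatewise in a product. *)
Lemma normal_form_map (x : tensor P A) (X : A -> P) :
  normal_form x X -> normal_form (tensor_map f x) (f \o X).
Proof.
have [_ fI _] := fP; move=> [Xd ->]; split.
  by move=> a b a0 b0 ab /=; rewrite -fI Xd// (boolean_hom0 fP).
pose f_add := GRing.isZmodMorphism.Build _ _ _ (@tensor_mapB _ _ P Q A f fP).
pose fa : {additive tensor P A -> tensor Q A} := HB.pack (@tensor_map _ _ P Q A f) f_add.
rewrite -[tensor_map f]/(fa : _ -> _) raddf_sum.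
by apply: eq_bigr => a _; rewrite /= tensor_map_tens.
Qed.

Lemma tensor_map_surj : (forall Y, exists X, f X = Y) ->
  forall y : tensor Q A, exists x : tensor P A, tensor_map f x = y.
Proof.
move=> f_surj; have fB := @tensor_mapB _ _ P Q A f fP.
apply: presented_ind => [|_ _ [x <-] [y <-]|[Y a]].
- by exists (0 - 0); rewrite fB subrr.
- by exists (x - y); rewrite fB.
- by have [X <-] := f_surj Y; exists (tens X a); rewrite tensor_map_tens.
Qed.

End TensorFunctoriality.

Section MeasuredFunctoriality.
Variables (R : realType) (Gam : groupType) (A : finZmodType).

Definition equivariant_hom (P Q : measured_gba R Gam) (f : P -> Q) : Prop :=
  boolean_hom f /\ forall g X, f (bact g X) = bact g (f X).

Variables (P Q : measured_gba R Gam) (f : P -> Q) (fP : equivariant_hom f).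

Fact tensor_hom_subproof :
  is_ghomb (tensor_map f : tensor_module P A -> tensor_module Q A).
Proof.
have [fB fJ] := fP; have tB := @tensor_mapB _ _ P Q A f fB.
apply/asboolP; split=> // g; apply: presented_eq => [x y|x y|[X a]].
- by rewrite gactB tB.
- by rewrite tB gactB.
- by rewrite -[pgen _ _]/(tens X a) /= tensor_act_tens !tensor_map_tens// tensor_act_tens fJ.
Qed.
Definition tensor_hom : ghom (tensor_module P A) (tensor_module Q A) :=
  Ghom tensor_hom_subproof.

Lemma tensor_mu_map (x : tensor P A) : (forall X, mu (f X) = mu X) ->
  tensor_mu (tensor_map f x) = tensor_mu x.
Proof.
move=> f_mu; have [X xX] := normal_form_exists x.
rewrite (tensor_mu_normal_form xX) (tensor_mu_normal_form (normal_form_map fP.1 xX)).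
by apply: eq_bigr => a _; rewrite /= f_mu.
Qed.

Variable (E : gcomplex Gam).

Lemma tensor_hom_theta n (a : cocycle E n (trivial_module Gam A)) :
  cocycle_map tensor_hom (cocycle_map (theta P A) a) = cocycle_map (theta Q A) a.
Proof.
apply/val_inj/val_inj/funext => x /=.
by rewrite tensor_map_tens ?(boolean_hom1 fP.1)//; exact: fP.1.
Qed.

Lemma theta_star_map n (alpha : cohomology E n (trivial_module Gam A))
    (c : cocycle E n (tensor_module P A)) :
  coclass c = theta_star P alpha ->
  coclass (cocycle_map tensor_hom c) = theta_star Q alpha.
Proof.
rewrite /theta_star /cohomology_map => cE.
by rewrite -(cohomology_map_coclass tensor_hom) cE cohomology_map_coclass tensor_hom_theta.
Qed.

(** The cocycle c is cohomologous to theta(a) for some cocycle a with values in A,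
    and theta(a) always lifts, to theta(a) itself over P. *)
Lemma theta_star_lift n (alpha : cohomology E n (trivial_module Gam A))
    (c : cocycle E n (tensor_module Q A)) :
  (forall Y, exists X, f X = Y) -> coclass c = theta_star Q alpha ->
  exists2 c' : cocycle E n (tensor_module P A),
    coclass c' = theta_star P alpha & cocycle_map tensor_hom c' = c.
Proof.
move=> f_surj; rewrite /theta_star /cohomology_map -tensor_hom_theta.
by apply: cocycle_lift; exact: (tensor_map_surj fP.1).
Qed.

End MeasuredFunctoriality.

Section NormFunctoriality.
Variables (R : realType) (Gam : groupType) (E : finite_type_model R Gam).
Variables (nu : faithful_probas R E) (A : finZmodType).

Lemma tensor_mu_ge0 (P : measured_ba R) (x : tensor P A) : 0 <= tensor_mu x.
Proof. by apply: sumr_ge0 => a _; exact: mu_ge0. Qed.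

Lemma cochain_norm_ge0 (P : measured_gba R Gam) n (c : cochain E n (tensor_module P A)) :
  0 <= cochain_norm nu c.
Proof. by apply: fsumr_ge0 => x _; rewrite mulr_ge0 ?tensor_mu_ge0 ?ltW ?proba_gt0. Qed.

Lemma cochain_norm_map (P Q : measured_gba R Gam) (f : P -> Q) (fP : equivariant_hom f) n
    (c : cocycle E n (tensor_module P A)) : (forall X, mu (f X) = mu X) ->
  cochain_norm nu (cocycle_map (tensor_hom A fP) c) = cochain_norm nu c.
Proof. by move=> f_mu; apply: eq_fsbigr => x _; rewrite /= tensor_mu_map. Qed.

Lemma class_norm_le (P : measured_gba R Gam) n (c : cocycle E n (tensor_module P A)) :
  class_norm nu (coclass c) <= cochain_norm nu c.
Proof.
apply: ge_inf; last by exists c.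
by exists 0 => _ [c' _ <-]; exact: cochain_norm_ge0.
Qed.

Lemma class_norm_adherent (P : measured_gba R Gam) n
    (b : cohomology E n (tensor_module P A)) e : 0 < e ->
  exists2 c, coclass c = b & cochain_norm nu (cocycle_cochain c) < class_norm nu b + e.
Proof.
move=> e0; have [|_ [c /= cb <-] ce] := @inf_adherent R
  [set cochain_norm nu c | c in [set c : cocycle E n (tensor_module P A) | coclass c = b]] e e0.
- split; last by exists 0 => _ [c' _ <-]; exact: cochain_norm_ge0.
  by exists (cochain_norm nu (repr (b : {ideal_quot (@is_coboundary _ E n (tensor_module P A))})%qT)), (repr b); rewrite //= /coclass reprK.
- by exists c.
Qed.

End NormFunctoriality.

(** * The product of a family, measured through its ultraproduct *)

Section ProductAlgebra.
Variables (R : realType) (Gam : groupType) (I : Type) (U : set_system I).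
Context {UU : UltraFilter U}.
Variable Q : I -> measured_gba R Gam.

Definition product_algebra := prod_family Q.
HB.instance Definition _ := Choice.on product_algebra.
Local Notation D := product_algebra.
Implicit Types X Y Z : D.

Let DP X Y : (forall j, X j = Y j) -> X = Y.
Proof. by move=> XY; apply/functional_extensionality_dep. Qed.

Let meet X Y : D := fam_meet X Y.
Let join X Y : D := fam_join X Y.
Let le X Y := meet X Y == X.
Let lt X Y := (Y != X) && le X Y.

Fact product_meetC : commutative meet.
Proof. by move=> X Y; apply: DP => j; exact: meetC. Qed.
Fact product_joinC : commutative join.
Proof. by move=> X Y; apply: DP => j; exact: joinC. Qed.
Fact product_meetA : associative meet.
Proof. by move=> X Y Z; apply: DP => j; exact: meetA. Qed.
Fact product_joinA : associative join.
Proof. by move=> X Y Z; apply: DP => j; exact: joinA. Qed.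
Fact product_joinKI Y X : meet X (join X Y) = X.
Proof. by apply: DP => j; exact: joinKI. Qed.
Fact product_meetKU Y X : join X (meet X Y) = X.
Proof. by apply: DP => j; exact: meetKU. Qed.
Fact product_meetUl : left_distributive meet join.
Proof. by move=> X Y Z; apply: DP => j; exact: meetUl. Qed.
Fact product_meetxx : idempotent_op meet.
Proof. by move=> X; apply: DP => j; exact: meetxx. Qed.
HB.instance Definition _ :=
  @Order.isMeetJoinDistrLattice.Build (Order.Disp tt tt) D le lt
    meet join (fun _ _ => erefl) (fun _ _ => erefl)
    product_meetC product_joinC product_meetA product_joinA
    product_joinKI product_meetKU product_meetUl product_meetxx.

Let bot : D := fun j => \bot%O.
Let top : D := fun j => \top%O.
Let compl X : D := fam_compl X.

Fact product_le0x X : (bot <= X)%O.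
Proof. by apply/eqP/DP => j; exact: meet0x. Qed.
Fact product_lex1 X : (X <= top)%O.
Proof. by apply/eqP/DP => j; exact: meetx1. Qed.
HB.instance Definition _ := @Order.hasBottom.Build _ D _ product_le0x.
HB.instance Definition _ := @Order.hasTop.Build _ D _ product_lex1.

Fact product_joinxC X : (X `|` compl X)%O = \top%O.
Proof. by apply: DP => j; exact: joinxC. Qed.
Fact product_meetxC X : (X `&` compl X)%O = \bot%O.
Proof. by apply: DP => j; exact: meetxC. Qed.
HB.instance Definition _ :=
  @Order.TBDistrLattice_hasComplement.Build _ D compl product_joinxC product_meetxC.

(** The pullback of the measure of the ultraproduct, i.e. the limit along U of the
    measures of the coordinates. With it the projection to the ultraproduct preserves
    measures, so that lifting a cocycle along it keeps the norm. *)
Definition product_mu X : R := mu ((\pi_(ultra U Q) X)%qT : ultraproduct_ba U Q).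

Fact pi_boolean_hom :
  @boolean_hom _ _ D (ultraproduct_ba U Q) (fun X => (\pi_(ultra U Q) X)%qT).
Proof.
split.
- exact: pi_ultra_join.
- exact: pi_ultra_meet.
- exact: pi_ultra_compl.
Qed.

Fact product_mu_itv X : 0 <= product_mu X <= 1.
Proof. exact: mu_itv. Qed.
Fact product_muUI X Y :
  product_mu (X `|` Y)%O + product_mu (X `&` Y)%O = product_mu X + product_mu Y.
Proof. by have [fU fI _] := pi_boolean_hom; rewrite /product_mu fU fI muUI. Qed.
Fact product_mu0 : product_mu \bot%O = 0.
Proof. by rewrite /product_mu (boolean_hom0 pi_boolean_hom) mu0. Qed.
Fact product_mu1 : product_mu \top%O = 1.
Proof. by rewrite /product_mu (boolean_hom1 pi_boolean_hom) mu1. Qed.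

Definition product_ba : measured_ba R :=
  MeasuredBA product_mu_itv product_muUI product_mu0 product_mu1.

Let act g X : D := fam_act g X.

Fact product_act_hom g : @boolean_hom _ _ product_ba product_ba (act g).
Proof.
split=> [X Y|X Y|X]; apply: DP => j; have [fU fI fC] := bact_hom (Q j) g.
- exact: fU.
- exact: fI.
- exact: fC.
Qed.
Fact product_act1 X : act 1%g X = X.
Proof. by apply: DP => j; exact: bact1. Qed.
Fact product_actM g h X : act (g * h)%g X = act g (act h X).
Proof. by apply: DP => j; exact: bactM. Qed.
Fact product_act_mu g X : product_mu (act g X) = product_mu X.
Proof.
by rewrite /product_mu (pi_ultra_act (U := U) g X) (bact_mu (m := ultraproduct U Q)).
Qed.

Definition product_gba : measured_gba R Gam :=
  @MeasuredGBA R Gam product_ba act product_act_hom product_act1 product_actM product_act_mu.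

Definition product_pi (X : product_gba) : ultraproduct U Q := (\pi_(ultra U Q) X)%qT.
Definition product_eval j (X : product_gba) : Q j := X j.

Lemma product_pi_hom : equivariant_hom product_pi.
Proof. by split=> [|g X]; [exact: pi_boolean_hom|exact: pi_ultra_act]. Qed.

Lemma product_pi_surj (Y : ultraproduct U Q) : exists X, product_pi X = Y.
Proof. by exists (repr (Y : ultra U Q)); rewrite /product_pi reprK. Qed.

Lemma product_eval_hom j : equivariant_hom (product_eval j).
Proof. by []. Qed.

Lemma cvg_mu_eval (X : product_gba) : mu (product_eval j X) @[j --> U] --> mu X.
Proof. by rewrite [mu X]ultra_mu_pi; exact: mu_cvg. Qed.

(** A single normal form of x in the product gives a normal form in every coordinate,
    so the limit is taken over a fixed finite sum. *)
Lemma cvg_tensor_mu_eval (A : finZmodType) (x : tensor product_gba A) :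
  tensor_mu (tensor_map (product_eval j) x) @[j --> U] --> tensor_mu x.
Proof.
have [X xX] := normal_form_exists x; rewrite (tensor_mu_normal_form xX).
under eq_fun => j do
  rewrite (tensor_mu_normal_form (normal_form_map (product_eval_hom j).1 xX)).
by apply: cvg_big => [|a _]; [exact: add_continuous|exact: cvg_mu_eval].
Qed.

Lemma cvg_cochain_norm_eval (E : finite_type_model R Gam) (nu : faithful_probas R E)
    (A : finZmodType) n (c : cocycle E n (tensor_module product_gba A)) :
  cochain_norm nu (cocycle_map (tensor_hom A (product_eval_hom j)) c) @[j --> U]
    --> cochain_norm nu c.
Proof.
rewrite /cochain_norm fsbig_finite; last exact: ftm_finite.
under eq_fun do rewrite (fsbig_finite _ _ (@ftm_finite _ _ E n)).
apply: cvg_big => [|x _]; first exact: add_continuous.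
by apply: cvgM; [exact: cvg_tensor_mu_eval|exact: cvg_cst].
Qed.

End ProductAlgebra.

(** * Weak containment and norms *)

Lemma class_norm_weakly_contained (R : realType) (Gam : groupType)
    (E : finite_type_model R Gam) (nu : faithful_probas R E)
    (A : finZmodType) (P : measured_gba R Gam) (F : measured_gba R Gam -> Prop)
    n (alpha : cohomology E n (trivial_module Gam A)) e :
  weakly_contained P F -> 0 < e ->
  exists2 Q, F Q & class_norm nu (theta_star Q alpha) < class_norm nu (theta_star P alpha) + e.
Proof.
move=> [I [U [UU [Q [_ FQ [f [fB fJ f_mu]]]]]]] e0.
have fP : equivariant_hom f by [].
have [c cE c_lt] := class_norm_adherent nu (theta_star P alpha) e0.
have [c' c'E c'f] :=
  theta_star_lift (product_pi_hom Q) (product_pi_surj (Q := Q)) (theta_star_map fP cE).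
(* c' lives on the product; its image in the ultraproduct is that of c. *)
have c'_norm : cochain_norm nu c' = cochain_norm nu c.
  rewrite -(cochain_norm_map nu fP c f_mu) -c'f.
  by apply/esym/cochain_norm_map.
have := cvg_cochain_norm_eval (nu := nu) (c := c'); rewrite c'_norm => /cvgr_lt /(_ _ c_lt).
move=> /filter_ex[j c'_lt]; exists (Q j); first exact: FQ.
apply: le_lt_trans c'_lt; rewrite -(theta_star_map (product_eval_hom Q j) c'E).
exact: (class_norm_le nu (cocycle_map _ c')).
Qed.

Theorem corollary2p14 (R : realType) (Gam : groupType)
    (E : finite_type_model R Gam) (nu : faithful_probas R E)
    (A : finZmodType) (P : measured_gba R Gam)
    (F : measured_gba R Gam -> Prop)
    (i : nat) (alpha : cohomology E i (trivial_module Gam A)) :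
  ((class_norm nu (theta_star P alpha))%:E <
    ereal_inf [set y : \bar R | exists2 Q : measured_gba R Gam,
      F Q & y = (class_norm nu (theta_star Q alpha))%:E])%E ->
  ~ weakly_contained P F.
Proof.
rewrite ltNge => /negP P_lt PF; apply: P_lt; apply/lee_addgt0Pr => e e0.
have [Q FQ Q_lt] := class_norm_weakly_contained nu alpha PF e0.
apply: ereal_inf_le; exists (class_norm nu (theta_star Q alpha))%:E; first by exists Q.
by rewrite -EFinD lee_fin ltW.
Qed.
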